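(* (i) Let $l\in\mathbb{N}$, $\tau\in\mathbb{R}$, $-1\leq\delta<(2l-1)-1$ and $a\in\mathcal{A}^{\tau}_{\delta}(\mathbb{R})$. Then for any $N\in\mathbb{N}$, $$Os\text{-}\int_{-\infty}^{\infty}e^{\pm i\lambda x^{2l-1}}a(x)\,dx=\frac{2}{2l-1}\sum_{k=0}^{N-1}\left\{\cos\frac{\pi(2k+1)}{2(2l-1)}\,\Gamma\left(\frac{2k+1}{2l-1}\right)\frac{a^{(2k)}(0)}{(2k)!}\lambda^{-\frac{2k+1}{2l-1}}\pm i\sin\frac{\pi(2k+2)}{2(2l-1)}\,\Gamma\left(\frac{2k+2}{2l-1}\right)\frac{a^{(2k+1)}(0)}{(2k+1)!}\lambda^{-\frac{2k+2}{2l-1}}\right\}+O\Big(\lambda^{-\frac{N+1}{2l-1}}\Big)$$ as $\lambda\to\infty$. (ii) Let $l\in\mathbb{N}$, $\tau\in\mathbb{R}$, $-1\leq\delta<2l-1$ and $a\in\mathcal{A}^{\tau}_{\delta}(\mathbb{R})$. Then for any $N\in\mathbb{N}$, $$Os\text{-}\int_{-\infty}^{\infty}e^{\pm i\lambda x^{2l}}a(x)\,dx=\frac{1}{l}\sum_{k=0}^{N-1}e^{\pm i\frac{\pi}{2}\frac{2k+1}{2l}}\,\Gamma\left(\frac{2k+1}{2l}\right)\frac{a^{(2k)}(0)}{(2k)!}\lambda^{-\frac{2k+1}{2l}}+O\Big(\lambda^{-\frac{N}{l}}\Big)$$ as $\lambda\to\infty$.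
   Context: $\mathbb{N}=\{1,2,\dots\}$; $\langle x\rangle:=(1+|x|^{2})^{1/2}$; double signs $\pm$ are in the same order; $\Gamma$ is the Gamma function. Amplitude class: for $\tau,\delta\in\mathbb{R}$, a complex-valued $a\in C^{\infty}(\mathbb{R})$ belongs to $\mathcal{A}^{\tau}_{\delta}(\mathbb{R})$ if for each $k\in\mathbb{Z}_{\geq 0}$ there is $C_{k}>0$ with $|a^{(k)}(x)|\leq C_{k}\langle x\rangle^{\tau+\delta k}$ for all $x\in\mathbb{R}$. In connection with the phase $x^{m}$ it is always required that $-1\leq\delta<m-1$. Oscillatory integral: for $\lambda>0$ and $m\in\mathbb{N}$, $Os\text{-}\int_{-\infty}^{\infty}e^{\pm i\lambda x^{m}}a(x)\,dx:=\lim_{\varepsilon\to+0}\int_{-\infty}^{\infty}e^{\pm i\lambda x^{m}}a(x)\chi(\varepsilon x)\,dx$, which exists if this limit of improper integrals exists and is the same for every Schwartz function $\chi\in\mathcal{S}(\mathbb{R})$ with $\chi(0)=1$. *)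

(* Defs.v *)
From Stdlib Require Export Reals Factorial.
From Coquelicot Require Export Coquelicot.
Open Scope R_scope.

(* Derivatives of f : R -> C are taken componentwise; [Derive_n] is a total
   function, so [Cderive_n f n x] is f^(n)(x) only when f is smooth. *)
Definition Cderive_n (f : R -> C) (n : nat) (x : R) : C :=
  (Derive_n (fun t => Re (f t)) n x, Derive_n (fun t => Im (f t)) n x).

Definition Csmooth (f : R -> C) : Prop :=
  forall (n : nat) (x : R),
    ex_derive_n (fun t => Re (f t)) n x /\ ex_derive_n (fun t => Im (f t)) n x.

Definition japanese (x : R) : R := sqrt (1 + x ^ 2).

Definition amplitude (tau delta : R) (a : R -> C) : Prop :=
  Csmooth a /\
  forall k : nat, exists Ck : R, 0 < Ck /\
    forall x : R,
      Cmod (Cderive_n a k x) <= Ck * Rpower (japanese x) (tau + delta * INR k).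

Definition schwartz (chi : R -> C) : Prop :=
  Csmooth chi /\
  forall j k : nat, exists M : R,
    forall x : R, Rabs x ^ j * Cmod (Cderive_n chi k x) <= M.

(* e^{i theta} *)
Definition expi (theta : R) : C := (cos theta, sin theta).

Definition is_improper_RInt (f : R -> C) (v : C) : Prop :=
  is_RInt_gen (V := C_R_NormedModule) f
    (Rbar_locally m_infty) (Rbar_locally p_infty) v.

(* L is the value of Os-int e^{i s lam x^m} a(x) dx, with s = 1 or s = -1:
   for each cutoff chi all the regularized integrals J eps converge, and they
   tend to the same L as eps -> +0, independently of chi. *)
Definition is_Os_int (s lam : R) (m : nat) (a : R -> C) (L : C) : Prop :=
  forall chi : R -> C, schwartz chi -> chi 0 = RtoC 1 ->
    exists J : R -> C,
      (forall eps : R, 0 < eps ->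
         is_improper_RInt
           (fun x => (expi (s * lam * x ^ m) * a x * chi (eps * x)%R)%C) (J eps)) /\
      filterlim J (at_right 0) (locally (T := C_R_NormedModule) L).

(* Euler's integral, convergent for x > 0. *)
Definition Gamma (x : R) : R :=
  RInt_gen (V := R_CompleteNormedModule)
    (fun t => Rpower t (x - 1) * exp (- t)) (at_right 0) (Rbar_locally p_infty).

(* f = O(g) as lam -> +oo, for g >= 0. *)
Definition bigO_p_infty (f : R -> C) (g : R -> R) : Prop :=
  exists M : R, Rbar_locally p_infty (fun lam => Cmod (f lam) <= M * g lam).

(* The two finite sums below run over k = 0, ..., N-1, which [sum_n _ (N - 1)]
   expresses for N >= 1 only. *)

Definition odd_expansion (s : R) (l : nat) (a : R -> C) (N : nat) (lam : R) : C :=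
  let m := INR (2 * l - 1) in
  (RtoC (2 / m) *
   sum_n (G := C_AbelianGroup) (fun k : nat =>
     let p := INR (2 * k + 1) in
     let q := INR (2 * k + 2) in
     RtoC (cos (PI * p / (2 * m))) * RtoC (Gamma (p / m))
       * (Cderive_n a (2 * k) 0 / RtoC (INR (fact (2 * k))))
       * RtoC (Rpower lam (- (p / m)))
     + RtoC s * Ci * RtoC (sin (PI * q / (2 * m))) * RtoC (Gamma (q / m))
       * (Cderive_n a (2 * k + 1) 0 / RtoC (INR (fact (2 * k + 1))))
       * RtoC (Rpower lam (- (q / m)))) (N - 1))%C.

Definition even_expansion (s : R) (l : nat) (a : R -> C) (N : nat) (lam : R) : C :=
  let m := INR (2 * l) in
  (RtoC (1 / INR l) *
   sum_n (G := C_AbelianGroup) (fun k : nat =>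
     let p := INR (2 * k + 1) in
     expi (s * (PI / 2 * (p / m))) * RtoC (Gamma (p / m))
       * (Cderive_n a (2 * k) 0 / RtoC (INR (fact (2 * k))))
       * RtoC (Rpower lam (- (p / m)))) (N - 1))%C.

(* Main.v *)
Require Import Defs.
From Stdlib Require Import Reals Lra Lia ClassicalEpsilon FunctionalExtensionality.
From Coquelicot Require Import Coquelicot.
Open Scope R_scope.

(** Taking real and imaginary parts of amplitude and cutoff, and reflecting
x < 0 to x > 0, reduces everything to the real half-line integrals of
cos (lam x^m + th) f(x) psi(eps x), where th = 0 and th = -pi/2 give the two
parts of the exponential.  Write u = x^(1-m) f.  Integration by parts replaces
f psi(eps x) by u' psi(eps x) + (u/x) psi~(eps x), up to a factor 1/(m lam) and
boundary terms, where psi~(t) = t psi'(t) is again a cutoff, but vanishes at 0.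
Each step lowers the order of f at infinity by m - 1 - delta > 0, so after
finitely many steps dominated convergence gives a limit of the form psi(0) E,
the psi~ terms contributing nothing.  If f vanishes to order n m at 0, then n
steps produce no boundary terms, hence E = O(lam^-n); applied to a Taylor
remainder this yields the error bound.  Since E does not depend on the cutoff,
for f = x^j it can be computed with psi(t) = exp(-t^m), by rotating the
contour into the Gamma integral. *)

(** * Dominated improper integrals *)

(** The obstacle is the cutoff: the limit must be the same for every Schwartz function, yet it can
    be computed explicitly only for exp(-t^m), which for odd m blows up at -infinity. Hence the
    conditions on half-line cutoffs concern t >= 0 alone, and the limit is always sought in the form
    psi(0) E with E chosen before psi. The hypothesis delta < m - 1 makes the gain per integration
    by parts positive; delta >= -1 allows negative powers of x to be differentiated inside the
    symbol class. Convergence at infinity is treated on [1, infinity), where boundary terms at 1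
    cost only a bounded amount; decay in lam is obtained on the whole half-line, where vanishing at
    0 removes the boundary terms. The Taylor polynomial that is subtracted is longer than the
    expansion asked for: its surplus terms go into the error, and its growth at infinity is paid for
    by further integrations by parts. For eps > 0 the rotation angle stays below pi/2, so every
    integral that is rotated decays exponentially. *)

Lemma atan_lim_p_infty : filterlim atan (Rbar_locally p_infty) (locally (PI / 2)).
Proof.
  apply (filterlim_ext_loc (fun x => PI / 2 - atan (/ x))).
  - exists 0; intros x Hx. pose proof (atan_inv x Hx). lra.
  - cut (filterlim (fun x => PI / 2 - atan (/ x)) (Rbar_locally p_infty) (locally (PI / 2 - atan 0))).
    { rewrite atan_0, Rminus_0_r. trivial. }
    apply (filterlim_comp _ _ _ (fun x => / x) (fun y => PI / 2 - atan y) _ (locally 0)).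
    + apply (filterlim_Rbar_inv p_infty); discriminate.
    + apply (ex_derive_continuous (fun y => PI / 2 - atan y) 0). auto_derive. trivial.
Qed.

Lemma continuous_at_right (f : R -> R) (c : R) :
  continuous f c -> filterlim f (at_right c) (locally (f c)).
Proof. intros H P HP. specialize (H P HP). destruct H as [e He]. exists e. auto. Qed.

Lemma atan_lim_right (c : R) : filterlim atan (at_right c) (locally (atan c)).
Proof. apply continuous_at_right. apply (ex_derive_continuous atan). auto_derive; trivial. Qed.

Lemma filterlim_Rabs_lt {T : Type} (F : (T -> Prop) -> Prop) {FF : Filter F} (f : T -> R) (l : R) :
  filterlim f F (locally l) <-> forall d, 0 < d -> F (fun x => Rabs (f x - l) < d).
Proof.
  split.
  - intros H d Hd.
    apply (H (fun y => Rabs (y - l) < d)). exists (mkposreal d Hd). intros y Hy. exact Hy.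
  - intros H. apply filterlim_locally. intros eps. exact (H eps (cond_pos eps)).
Qed.

Lemma at_point_lim (f : R -> R) (c : R) : filterlim f (at_point c) (locally (f c)).
Proof. intros P HP. apply (locally_singleton _ _ HP). Qed.

Lemma cont_mult (f g : R -> R) (x : R) :
  continuous f x -> continuous g x -> continuous (fun t => f t * g t) x.
Proof. intros; apply (continuous_mult f g); assumption. Qed.

Lemma is_derive_cont (f : R -> R) (x l : R) : is_derive f x l -> continuous f x.
Proof. intros H; apply (ex_derive_continuous f); exists l; exact H. Qed.

Lemma filter_prod_segment (Fa Fb : (R -> Prop) -> Prop) (D : R -> Prop) :
  (forall x y z, D x -> D z -> x <= y <= z -> D y) -> Fa D -> Fb D ->
  filter_prod Fa Fb (fun ab : R * R =>
    forall x, Rmin (fst ab) (snd ab) <= x <= Rmax (fst ab) (snd ab) -> D x).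
Proof.
  intros HD Ha Hb. apply (Filter_prod _ _ _ D D Ha Hb). intros a b Da Db x Hx. simpl in Hx.
  destruct (Rle_dec a b).
  - rewrite Rmin_left, Rmax_right in Hx by lra. apply (HD a x b); auto.
  - rewrite Rmin_right, Rmax_left in Hx by lra. apply (HD b x a); auto.
Qed.

Lemma cont_ex_RInt (g : R -> R) (a b : R) :
  (forall x, Rmin a b <= x <= Rmax a b -> continuous g x) -> ex_RInt g a b.
Proof. intros H. apply (ex_RInt_continuous (V := R_CompleteNormedModule)). exact H. Qed.

Lemma is_RInt_atan (C a b : R) : is_RInt (fun x => C / (1 + x ^ 2)) a b (C * (atan b - atan a)).
Proof.
  replace (C * (atan b - atan a)) with (minus (C * atan b) (C * atan a))
    by (unfold minus, plus, opp; simpl; ring).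
  apply (is_RInt_derive (fun x => C * atan x)).
  - intros x _. auto_derive; [trivial|]. unfold Rsqr. field. nra.
  - intros x _. apply (ex_derive_continuous (fun x => C / (1 + x ^ 2))). auto_derive. nra.
Qed.

Lemma RInt_atan_bound (g : R -> R) (C a b : R) :
  (forall x, Rmin a b <= x <= Rmax a b -> continuous g x) ->
  (forall x, Rmin a b <= x <= Rmax a b -> Rabs (g x) <= C / (1 + x ^ 2)) ->
  Rabs (RInt g a b) <= C * Rabs (atan b - atan a).
Proof.
  assert (Hmain : forall a b, a <= b ->
    (forall x, a <= x <= b -> continuous g x) ->
    (forall x, a <= x <= b -> Rabs (g x) <= C / (1 + x ^ 2)) ->
    Rabs (RInt g a b) <= C * Rabs (atan b - atan a)).
  { clear a b. intros a b Hab Hc Hg.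
    assert (0 <= C).
    { assert (H := Hg a ltac:(lra)). pose proof (Rabs_pos (g a)).
      assert (0 < 1 + a ^ 2) by nra.
      apply (Rmult_le_reg_r (/ (1 + a ^ 2))); [apply Rinv_0_lt_compat; lra|].
      unfold Rdiv in H. lra. }
    rewrite (Rabs_pos_eq (atan b - atan a)).
    - apply (norm_RInt_le g (fun x => C / (1 + x ^ 2)) a b); auto.
      + apply (RInt_correct (V := R_CompleteNormedModule)). apply cont_ex_RInt.
        rewrite Rmin_left, Rmax_right by lra. exact Hc.
      + apply is_RInt_atan.
    - destruct (Rle_lt_or_eq_dec a b Hab) as [H1|H1].
      + pose proof (atan_increasing a b H1). lra.
      + subst; lra. }
  intros Hc Hg. destruct (Rle_dec a b).
  - rewrite Rmin_left, Rmax_right in Hc by lra. rewrite Rmin_left, Rmax_right in Hg by lra. auto.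
  - rewrite Rmin_right, Rmax_left in Hc by lra. rewrite Rmin_right, Rmax_left in Hg by lra.
    rewrite <- (opp_RInt_swap (V := R_CompleteNormedModule)).
    + unfold opp; simpl. rewrite Rabs_Ropp, Rabs_minus_sym. apply Hmain; auto; lra.
    + apply cont_ex_RInt. rewrite Rmin_left, Rmax_right by lra. exact Hc.
Qed.

(** The majorant 1/(1+x^2) has the primitive [atan], which converges at every kind of endpoint used
    here, so the Cauchy criterion for the integral reduces to that for [atan]. Keeping the filters
    abstract lets one proof serve 0+, a fixed point and infinity; [D] is an interval which both
    filters eventually enter. *)
Lemma RInt_gen_dominated (g : R -> R) (D : R -> Prop) (C : R)
  (Fa Fb : (R -> Prop) -> Prop) {FFa : ProperFilter Fa} {FFb : ProperFilter Fb} (la lb : R) :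
  (forall x y z, D x -> D z -> x <= y <= z -> D y) ->
  Fa D -> Fb D ->
  filterlim atan Fa (locally la) -> filterlim atan Fb (locally lb) ->
  (forall x, D x -> continuous g x) ->
  (forall x, D x -> Rabs (g x) <= C / (1 + x ^ 2)) ->
  exists l : R, is_RInt_gen g Fa Fb l.
Proof.
  intros HD Ha Hb Hla Hlb Hc Hg.
  assert (HI : forall x y, D x -> D y -> forall z, Rmin x y <= z <= Rmax x y -> D z).
  { intros x y Hx Hy z Hz. unfold Rmin, Rmax in Hz. destruct (Rle_dec x y).
    - apply (HD x z y); auto.
    - apply (HD y z x); auto; lra. }
  assert (HE : forall x y, D x -> D y -> ex_RInt g x y).
  { intros x y Hx Hy. apply cont_ex_RInt. intros z Hz. apply Hc. apply (HI x y); auto. }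
  assert (HB : forall x y, D x -> D y -> Rabs (RInt g x y) <= C * Rabs (atan y - atan x)).
  { intros x y Hx Hy. apply RInt_atan_bound; intros z Hz; [apply Hc|apply Hg];
      apply (HI x y); auto. }
  assert (HC : 0 <= C).
  { destruct (filter_ex (F := Fa) D Ha) as [x Hx]. pose proof (Hg x Hx) as H.
    pose proof (Rabs_pos (g x)).
    assert (0 < 1 + x ^ 2) by nra.
    apply (Rmult_le_reg_r (/ (1 + x ^ 2))); [apply Rinv_0_lt_compat; lra|].
    unfold Rdiv in H. lra. }
  assert (HL : exists l : R, filterlim (fun ab : R * R => RInt g (fst ab) (snd ab)) (filter_prod Fa Fb) (locally l)).
  { apply (filterlim_locally_cauchy (U := R_CompleteSpace)).
    intros eps.
    (* Each end may move [atan] by [2 * d], so two integrals differ by at most 4 C d <= eps/2; the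
       [+ 1] covers C = 0. *)
    set (d := eps / (8 * (C + 1))).
    assert (Hd : 0 < d). { apply Rdiv_lt_0_compat; [apply eps|lra]. }
    exists (fun ab : R * R => (D (fst ab) /\ Rabs (atan (fst ab) - la) < d)
                  /\ (D (snd ab) /\ Rabs (atan (snd ab) - lb) < d)).
    split.
    - apply (Filter_prod _ _ _ (fun a => D a /\ Rabs (atan a - la) < d)
                               (fun b => D b /\ Rabs (atan b - lb) < d)); try tauto.
      + apply filter_and; auto. apply (proj1 (filterlim_Rabs_lt Fa atan la) Hla d Hd).
      + apply filter_and; auto. apply (proj1 (filterlim_Rabs_lt Fb atan lb) Hlb d Hd).
    - intros [a b] [a' b'] [[Da Ha1] [Db Hb1]] [[Da' Ha2] [Db' Hb2]].
      simpl in *.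
      change (Rabs (RInt g a' b' - RInt g a b) < eps).
      pose proof (RInt_Chasles (V := R_CompleteNormedModule) g a' a b' (HE _ _ Da' Da) (HE _ _ Da Db')) as E1.
      pose proof (RInt_Chasles (V := R_CompleteNormedModule) g a b b' (HE _ _ Da Db) (HE _ _ Db Db')) as E2.
      unfold plus in E1, E2; simpl in E1, E2.
      replace (RInt g a' b' - RInt g a b) with (RInt g a' a + RInt g b b') by lra.
      pose proof (HB a' a Da' Da) as B1. pose proof (HB b b' Db Db') as B2.
      assert (C * d <= eps / 8).
      { unfold d. apply (Rmult_le_reg_r (4 * (C + 1))); [lra|]. field_simplify; [|lra].
        pose proof (cond_pos eps). nra. }
      assert (Rabs (atan a - atan a') <= 2 * d).
      { revert Ha1 Ha2. unfold Rabs; repeat destruct Rcase_abs; lra. }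
      assert (Rabs (atan b' - atan b) <= 2 * d).
      { revert Hb1 Hb2. unfold Rabs; repeat destruct Rcase_abs; lra. }
      pose proof (Rabs_triang (RInt g a' a) (RInt g b b')).
      assert (C * Rabs (atan a - atan a') <= C * (2 * d)) by (apply Rmult_le_compat_l; lra).
      assert (C * Rabs (atan b' - atan b) <= C * (2 * d)) by (apply Rmult_le_compat_l; lra).
      pose proof (cond_pos eps). lra. }
  destruct HL as [l Hl]. exists l.
  apply (filterlimi_lim_ext_loc (fun ab : R * R => RInt g (fst ab) (snd ab))); [|exact Hl].
  apply (Filter_prod _ _ _ D D Ha Hb). intros x y Hx Hy. simpl.
  apply (RInt_correct (V := R_CompleteNormedModule)). apply HE; auto.
Qed.

Lemma is_RInt_gen_dominated_le (g : R -> R) (D : R -> Prop) (C : R)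
  (Fa Fb : (R -> Prop) -> Prop) {FFa : ProperFilter Fa} {FFb : ProperFilter Fb} (la lb l : R) :
  filter_prod Fa Fb (fun ab : R * R => fst ab <= snd ab) ->
  (forall x y z, D x -> D z -> x <= y <= z -> D y) ->
  Fa D -> Fb D ->
  filterlim atan Fa (locally la) -> filterlim atan Fb (locally lb) ->
  (forall x, D x -> Rabs (g x) <= C / (1 + x ^ 2)) ->
  is_RInt_gen g Fa Fb l -> Rabs l <= C * (lb - la).
Proof.
  intros Hle HD Ha Hb Hla Hlb Hg Hl.
  apply (RInt_gen_norm (Fa := Fa) (Fb := Fb) g (fun x => C / (1 + x ^ 2)) l (C * (lb - la)) Hle); auto.
  - apply (Filter_prod _ _ _ D D Ha Hb). intros x y Hx Hy z Hz. apply Hg. apply (HD x z y); auto.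
  - apply (filterlimi_lim_ext_loc (fun ab : R * R => C * (atan (snd ab) - atan (fst ab)))).
    + apply filter_forall. intros [a b]. apply is_RInt_atan.
    + apply (filterlim_comp_2 (F := filter_prod Fa Fb) (fun ab => atan (snd ab)) (fun ab => atan (fst ab))
        (fun u v => C * (u - v)) (G := locally lb) (H := locally la)).
      * apply (filterlim_comp _ _ _ snd atan _ Fb); auto. apply filterlim_snd.
      * apply (filterlim_comp _ _ _ fst atan _ Fa); auto. apply filterlim_fst.
      * apply (filterlim_comp_2 (fun ab : R * R => C) (fun ab => fst ab - snd ab) Rmult (G := locally C) (H := locally (lb - la))).
        -- apply filterlim_const.
        -- apply (filterlim_comp_2 (F := filter_prod (locally lb) (locally la)) fst (fun ab => - snd ab) Rplus (G := locally lb) (H := locally (- la))).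
           ++ apply filterlim_fst.
           ++ apply (filterlim_comp _ _ _ snd Ropp _ (locally la)). apply filterlim_snd. apply (filterlim_opp (V:=R_NormedModule)).
           ++ apply (filterlim_plus (V:=R_NormedModule)).
        -- apply (filterlim_mult (K:=R_AbsRing)).
Qed.

(** * Symbols and cutoffs *)

(** Independent exponents at 0 and at infinity, because integration by parts lowers the two orders
    by different amounts. The bound weakens when [J] decreases or when [tau] increases. *)
Definition weight (J tau x : R) : R :=
  if Rle_dec x 1 then Rpower x J else Rpower x tau.

Lemma Rpower_pos (x y : R) : 0 < Rpower x y.
Proof. apply exp_pos. Qed.

Lemma Rpower_le_exp (x p q : R) : 1 <= x -> p <= q -> Rpower x p <= Rpower x q.
Proof.
  intros Hx H. destruct (Rle_lt_or_eq_dec 1 x Hx) as [H1|H1].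
  - apply Rle_Rpower; lra.
  - subst. unfold Rpower. rewrite ln_1, !Rmult_0_r. lra.
Qed.

Lemma Rpower_le_exp_small (x p q : R) : 0 < x <= 1 -> p <= q -> Rpower x q <= Rpower x p.
Proof.
  intros [H0 H1] H. unfold Rpower.
  assert (ln x <= 0) by (rewrite <- ln_1; apply Rcomplements.ln_le; lra).
  assert (Hm : q * ln x <= p * ln x) by nra.
  destruct Hm as [Hm|Hm]; [left; apply exp_increasing; exact Hm|rewrite Hm; lra].
Qed.

Lemma weight_pos (J tau x : R) : 0 < weight J tau x.
Proof. unfold weight. destruct (Rle_dec x 1); apply Rpower_pos. Qed.

Lemma weight_mono (J J' tau tau' x : R) :
  J' <= J -> tau <= tau' -> 0 < x -> weight J tau x <= weight J' tau' x.
Proof.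
  intros. unfold weight. destruct (Rle_dec x 1).
  - apply Rpower_le_exp_small; lra.
  - apply Rpower_le_exp; lra.
Qed.

Lemma weight_mul (J tau q x : R) :
  Rpower x q * weight J tau x = weight (J + q) (tau + q) x.
Proof.
  unfold weight. destruct (Rle_dec x 1); rewrite Rpower_plus; ring.
Qed.

(* For k <= n, the k-th derivative of [f] is O(x^(J-k)) at 0 and
   O(x^(tau+delta k)) at infinity. *)
Fixpoint symbol (delta : R) (n : nat) (J tau : R) (f : R -> R) : Prop :=
  (exists C, forall x, 0 < x -> Rabs (f x) <= C * weight J tau x) /\
  match n with
  | O => forall x, 0 < x -> continuous f x
  | S n' => exists f', (forall x, 0 < x -> is_derive f x (f' x)) /\
                       symbol delta n' (J - 1) (tau + delta) f'
  end.

Lemma symbol_bound delta n J tau f : symbol delta n J tau f ->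
  exists C, 0 < C /\ forall x, 0 < x -> Rabs (f x) <= C * weight J tau x.
Proof.
  intros H. assert (H0 : exists C, forall x, 0 < x -> Rabs (f x) <= C * weight J tau x)
    by (destruct n; apply H).
  destruct H0 as [C HC]. exists (Rabs C + 1). split; [pose proof (Rabs_pos C); lra|].
  intros x Hx. eapply Rle_trans; [apply HC; auto|]. apply Rmult_le_compat_r.
  - left; apply weight_pos.
  - pose proof (Rle_abs C); lra.
Qed.

Lemma symbol_continuous delta n J tau f : symbol delta n J tau f ->
  forall x, 0 < x -> continuous f x.
Proof.
  destruct n; intros [_ H]; auto. destruct H as [f' [H _]].
  intros x Hx. apply (is_derive_cont f x (f' x)). auto.
Qed.

Lemma symbol_mono delta n : forall J J' tau tau' f, J' <= J -> tau <= tau' ->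
  symbol delta n J tau f -> symbol delta n J' tau' f.
Proof.
  assert (HB : forall J J' tau tau' f, J' <= J -> tau <= tau' ->
    (exists C, 0 < C /\ forall x, 0 < x -> Rabs (f x) <= C * weight J tau x) ->
    exists C, forall x, 0 < x -> Rabs (f x) <= C * weight J' tau' x).
  { intros J J' tau tau' f HJ Ht [C [HC H]]. exists C. intros x Hx.
    eapply Rle_trans; [apply H; auto|]. apply Rmult_le_compat_l; [lra|].
    apply weight_mono; auto. }
  induction n; intros J J' tau tau' f HJ Ht Hf; split;
    try (apply (HB J J' tau tau'); auto; apply (symbol_bound _ _ _ _ _ Hf)).
  - apply Hf.
  - destruct Hf as [_ [f' [H1 H2]]]. exists f'. split; auto.
    apply (IHn (J - 1) _ (tau + delta)); auto; lra.
Qed.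

Lemma symbol_pred delta n : forall J tau f,
  symbol delta (S n) J tau f -> symbol delta n J tau f.
Proof.
  induction n; intros J tau f Hf.
  - split; [apply Hf|]. apply (symbol_continuous _ _ _ _ _ Hf).
  - split; [apply Hf|]. destruct Hf as [_ [f' [H1 H2]]]. exists f'; split; auto.
Qed.

Lemma symbol_plus delta n : forall J tau f g,
  symbol delta n J tau f -> symbol delta n J tau g ->
  symbol delta n J tau (fun x => f x + g x).
Proof.
  induction n; intros J tau f g Hf Hg;
  (split; [destruct (symbol_bound _ _ _ _ _ Hf) as [C1 [_ H1]];
    destruct (symbol_bound _ _ _ _ _ Hg) as [C2 [_ H2]];
    exists (C1 + C2); intros x Hx; eapply Rle_trans; [apply Rabs_triang|];
    pose proof (H1 x Hx); pose proof (H2 x Hx); lra|]).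
  - intros x Hx. apply (continuous_plus f g); [apply Hf|apply Hg]; auto.
  - destruct Hf as [_ [f' [F1 F2]]], Hg as [_ [g' [G1 G2]]].
    exists (fun x => f' x + g' x). split; [|auto].
    intros x Hx. apply (is_derive_plus f g); auto.
Qed.

Lemma symbol_scal delta n c : forall J tau f,
  symbol delta n J tau f -> symbol delta n J tau (fun x => c * f x).
Proof.
  induction n; intros J tau f Hf;
  (split; [destruct (symbol_bound _ _ _ _ _ Hf) as [C1 [_ H1]];
    exists (Rabs c * C1); intros x Hx; rewrite Rabs_mult, Rmult_assoc;
    apply Rmult_le_compat_l; [apply Rabs_pos|auto]|]).
  - intros x Hx. apply (continuous_scal_r c f). apply Hf; auto.
  - destruct Hf as [_ [f' [F1 F2]]]. exists (fun x => c * f' x). split; [|auto].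
    intros x Hx. apply (is_derive_scal f x c). auto.
Qed.

Lemma is_derive_Rpower (q x : R) : 0 < x ->
  is_derive (fun t => Rpower t q) x (q * Rpower x (q - 1)).
Proof. intros Hx. apply is_derive_Reals. apply derivable_pt_lim_power. exact Hx. Qed.

(** Differentiating x^q changes the order at infinity by -1, whereas the class allows a change of
    [delta] per derivative; [-1 <= delta] is exactly what makes the first term of the product rule
    fit. *)
Lemma symbol_Rpower delta n : -1 <= delta -> forall q J tau f,
  symbol delta n J tau f ->
  symbol delta n (J + q) (tau + q) (fun x => Rpower x q * f x).
Proof.
  intros Hd. induction n; intros q J tau f Hf;
  (split; [destruct (symbol_bound _ _ _ _ _ Hf) as [C1 [_ H1]];
    exists C1; intros x Hx; rewrite Rabs_mult, (Rabs_pos_eq (Rpower x q)) by (left; apply Rpower_pos);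
    rewrite <- weight_mul; rewrite (Rmult_comm C1), Rmult_assoc; apply Rmult_le_compat_l;
    [left; apply Rpower_pos|rewrite Rmult_comm; auto]|]).
  - intros x Hx. apply (cont_mult (fun x => Rpower x q) f).
    + apply (is_derive_cont _ _ _ (is_derive_Rpower q x Hx)).
    + apply Hf; auto.
  - pose proof (symbol_pred _ _ _ _ _ Hf) as Hf0.
    destruct Hf as [_ [f' [F1 F2]]].
    exists (fun x => q * (Rpower x (q - 1) * f x) + Rpower x q * f' x). split.
    + intros x Hx.
      replace (q * (Rpower x (q - 1) * f x) + Rpower x q * f' x)
        with (plus (mult (q * Rpower x (q - 1)) (f x)) (mult (Rpower x q) (f' x)))
        by (unfold plus, mult; simpl; ring).
      apply (is_derive_mult (fun x => Rpower x q) f); auto.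
      * apply is_derive_Rpower; auto.
      * intros a b; apply Rmult_comm.
    + apply symbol_plus.
      * apply symbol_scal.
        apply (symbol_mono _ _ (J + (q - 1)) _ (tau + (q - 1))); try lra. apply IHn; auto.
      * replace (J + q - 1) with (J - 1 + q) by ring.
        replace (tau + q + delta) with (tau + delta + q) by ring. apply IHn; auto.
Qed.

Lemma symbol_zero delta n : forall J tau, symbol delta n J tau (fun _ => 0).
Proof.
  induction n; intros J tau; (split; [exists 0; intros x _; rewrite Rabs_R0; lra|]).
  - intros; apply continuous_const.
  - exists (fun _ => 0). split; auto. intros; apply (is_derive_const (K:=R_AbsRing) 0).
Qed.

Lemma symbol_of_derivatives delta n : forall (F : nat -> R -> R) J tau,
  (forall k x, 0 < x -> is_derive (F k) x (F (S k) x)) ->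
  (forall k, exists C, forall x, 0 < x ->
     Rabs (F k x) <= C * weight (J - INR k) (tau + delta * INR k) x) ->
  symbol delta n J tau (F O).
Proof.
  induction n; intros F J tau HF HB; split.
  1,3: destruct (HB O) as [C HC]; exists C; intros x Hx; specialize (HC x Hx);
    simpl INR in HC; rewrite Rmult_0_r, Rplus_0_r, Rminus_0_r in HC; exact HC.
  - intros x Hx. apply (is_derive_cont _ _ _ (HF O x Hx)).
  - exists (F 1%nat). split; auto.
    apply (IHn (fun k => F (S k))).
    + intros; auto.
    + intros k. destruct (HB (S k)) as [C HC]. exists C. intros x Hx.
      specialize (HC x Hx). rewrite S_INR in HC.
      replace (J - 1 - INR k) with (J - (INR k + 1)) by ring.
      replace (tau + delta + delta * INR k) with (tau + delta * (INR k + 1)) by ring. exact HC.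
Qed.

(** Decay is required on t >= 0 only, so that exp(-t^m) qualifies for odd m as well. The number [n]
    of derivatives is tracked because each integration by parts consumes one. *)
Fixpoint rapid (n : nat) (psi : R -> R) : Prop :=
  (forall j : nat, exists M, forall t, 0 <= t -> t ^ j * Rabs (psi t) <= M) /\
  match n with
  | O => True
  | S n' => exists psi', (forall t, is_derive psi t (psi' t)) /\ rapid n' psi'
  end.

Lemma rapid_bound n psi : rapid n psi ->
  forall j : nat, exists M, forall t, 0 <= t -> t ^ j * Rabs (psi t) <= M.
Proof. destruct n; intros H; apply H. Qed.

Lemma rapid_pred n : forall psi, rapid (S n) psi -> rapid n psi.
Proof.
  induction n; intros psi Hf; split; try apply Hf; auto.
  destruct Hf as [_ [f' [H1 H2]]]. exists f'; split; auto.
Qed.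

Lemma rapid_plus n : forall f g, rapid n f -> rapid n g -> rapid n (fun t => f t + g t).
Proof.
  induction n; intros f g Hf Hg;
  (split; [intros j; destruct (rapid_bound _ _ Hf j) as [C1 H1]; destruct (rapid_bound _ _ Hg j) as [C2 H2];
    exists (C1 + C2); intros t Ht; pose proof (H1 t Ht); pose proof (H2 t Ht);
    pose proof (Rabs_triang (f t) (g t)); pose proof (pow_le t j Ht); nra|]); auto.
  destruct Hf as [_ [f' [F1 F2]]], Hg as [_ [g' [G1 G2]]].
  exists (fun x => f' x + g' x). split; [|auto]. intros x. apply (is_derive_plus f g); auto.
Qed.

Lemma rapid_scal n c : forall f, rapid n f -> rapid n (fun t => c * f t).
Proof.
  induction n; intros f Hf;
  (split; [intros j; destruct (rapid_bound _ _ Hf j) as [C1 H1];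
    exists (Rabs c * C1); intros t Ht; pose proof (H1 t Ht); rewrite Rabs_mult;
    replace (t ^ j * (Rabs c * Rabs (f t))) with (Rabs c * (t ^ j * Rabs (f t))) by ring;
    apply Rmult_le_compat_l; [apply Rabs_pos|auto]|]); auto.
  destruct Hf as [_ [f' [F1 F2]]].
  exists (fun x => c * f' x). split; [|auto]. intros x. apply (is_derive_scal f x c); auto.
Qed.

(** Rapid decay absorbs the factor t, so passing from psi to t psi'(t) costs exactly one derivative,
    the same as what the amplitude loses in one integration by parts. *)
Lemma rapid_mult_id n : forall f, rapid n f -> rapid n (fun t => t * f t).
Proof.
  induction n; intros f Hf;
  (split; [intros j; destruct (rapid_bound _ _ Hf (S j)) as [C1 H1];
    exists C1; intros t Ht; pose proof (H1 t Ht) as H; rewrite Rabs_mult, (Rabs_pos_eq t Ht);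
    simpl in H; lra|]); auto.
  pose proof (rapid_pred _ _ Hf) as Hf0.
  destruct Hf as [_ [f' [F1 F2]]].
  exists (fun t => f t + t * f' t). split; [|apply rapid_plus; auto].
  intros x. auto_derive; [exists (f' x); auto|].
  replace (Derive (fun x0 => f x0) x) with (f' x) by (symmetry; apply is_derive_unique; auto). ring.
Qed.

Lemma rapid_of_derivatives n : forall (F : nat -> R -> R),
  (forall k x, is_derive (F k) x (F (S k) x)) ->
  (forall k j : nat, exists M, forall t, 0 <= t -> t ^ j * Rabs (F k t) <= M) ->
  rapid n (F O).
Proof.
  induction n; intros F HF HB; split; auto.
  exists (F 1%nat). split; auto. apply (IHn (fun k => F (S k))); auto.
Qed.

Lemma rapid_Lipschitz n psi : rapid (S n) psi ->
  exists M, 0 < M /\ forall t, 0 <= t -> Rabs (psi t - psi 0) <= M * t.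
Proof.
  intros [_ [psi' [H1 H2]]]. destruct (rapid_bound _ _ H2 O) as [M HM].
  exists (Rabs M + 1). split; [pose proof (Rabs_pos M); lra|].
  intros t Ht. destruct (MVT_gen psi 0 t psi') as [c [Hc E]].
  - intros; auto.
  - intros x Hx. apply continuity_pt_filterlim. apply (is_derive_cont _ _ _ (H1 x)).
  - rewrite Rmin_left, Rmax_right in Hc by lra. rewrite E, Rabs_mult, Rminus_0_r, (Rabs_pos_eq t Ht).
    apply Rmult_le_compat_r; auto. pose proof (HM c ltac:(lra)) as H; simpl in H.
    pose proof (Rle_abs M). lra.
Qed.

Lemma rapid_continuous n psi : rapid (S n) psi -> forall x, continuous psi x.
Proof. intros [_ [psi' [H1 H2]]] x. apply (is_derive_cont _ _ _ (H1 x)). Qed.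

(** * Regularized integrals and integration by parts *)

(** The phase [th] is arbitrary because each integration by parts turns the cosine into a sine,
    which is a cosine with [th] lowered by pi/2. The endpoints are filters so that (0,1], [1,
    infinity), the half-line and the line are all covered. *)
Definition osc_limit (m : nat) (Fa Fb : (R -> Prop) -> Prop) (lam th : R) (f psi : R -> R) (E : R) : Prop :=
  exists J : R -> R,
    (forall eps, 0 < eps ->
       is_RInt_gen (fun x => cos (lam * x ^ m + th) * (f x * psi (eps * x))) Fa Fb (J eps)) /\
    filterlim J (at_right 0) (locally E).

Lemma continuous_phase (m : nat) (lam th x : R) :
  continuous (fun x => cos (lam * x ^ m + th)) x.
Proof. apply (ex_derive_continuous (fun x => cos (lam * x ^ m + th))). auto_derive. trivial. Qed.

Lemma continuous_dilation (psi : R -> R) (eps x : R) :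
  continuous psi (eps * x) -> continuous (fun x => psi (eps * x)) x.
Proof.
  intros H. apply (continuous_comp (fun x => eps * x) psi); auto.
  apply (ex_derive_continuous (fun x => eps * x)). auto_derive. trivial.
Qed.

Lemma osc_limit_Chasles m Fa Fb {FFa : Filter Fa} {FFb : Filter Fb} c lam th f psi E1 E2 :
  osc_limit m Fa (at_point c) lam th f psi E1 -> osc_limit m (at_point c) Fb lam th f psi E2 ->
  osc_limit m Fa Fb lam th f psi (E1 + E2).
Proof.
  intros [J1 [H1 L1]] [J2 [H2 L2]]. exists (fun e => J1 e + J2 e). split.
  - intros eps He. apply (is_RInt_gen_Chasles (V := R_NormedModule) _ c); auto.
  - apply (filterlim_comp_2 J1 J2 Rplus L1 L2). apply (filterlim_plus (V := R_NormedModule)).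
Qed.

Lemma osc_limit_lin m Fa Fb {FFa : Filter Fa} {FFb : Filter Fb} lam th f g psi a b E1 E2 :
  osc_limit m Fa Fb lam th f psi E1 -> osc_limit m Fa Fb lam th g psi E2 ->
  osc_limit m Fa Fb lam th (fun x => a * f x + b * g x) psi (a * E1 + b * E2).
Proof.
  intros [J1 [H1 L1]] [J2 [H2 L2]]. exists (fun e => a * J1 e + b * J2 e). split.
  - intros eps He.
    apply (is_RInt_gen_ext (V := R_NormedModule) (fun x =>
      plus (scal a (cos (lam * x ^ m + th) * (f x * psi (eps * x))))
           (scal b (cos (lam * x ^ m + th) * (g x * psi (eps * x)))))).
    + apply filter_forall. intros ab x _. unfold plus, scal; simpl. unfold mult; simpl. ring.
    + apply (is_RInt_gen_plus (V := R_NormedModule)); apply (is_RInt_gen_scal (V := R_NormedModule)); auto.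
  - apply (filterlim_comp_2 (fun e => a * J1 e) (fun e => b * J2 e) Rplus (G := locally (a * E1)) (H := locally (b * E2))).
    + apply (filterlim_comp _ _ _ J1 (fun x => a * x) _ (locally E1)); auto.
      apply (filterlim_scal_r (V := R_NormedModule) a E1).
    + apply (filterlim_comp _ _ _ J2 (fun x => b * x) _ (locally E2)); auto.
      apply (filterlim_scal_r (V := R_NormedModule) b E2).
    + apply (filterlim_plus (V := R_NormedModule)).
Qed.

Lemma osc_limit_unique m Fa Fb {FFa : ProperFilter Fa} {FFb : ProperFilter Fb} lam th f psi E1 E2 :
  osc_limit m Fa Fb lam th f psi E1 -> osc_limit m Fa Fb lam th f psi E2 -> E1 = E2.
Proof.
  intros [J1 [H1 L1]] [J2 [H2 L2]].
  apply (filterlim_locally_unique (F := at_right 0) (V := R_NormedModule) J1); auto.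
  apply (filterlim_ext_loc J2); auto.
  exists (mkposreal 1 Rlt_0_1). intros y _ Hy.
  rewrite <- (is_RInt_gen_unique _ _ (H1 y Hy)). symmetry. apply (is_RInt_gen_unique (V := R_CompleteNormedModule)). auto.
Qed.

(** The bound on |f| makes the integral without cutoff converge, and its value is [E]. The bound on
    x |f| pays for the Lipschitz estimate |psi(eps x) - psi(0)| <= M eps x, so the regularized
    integral differs from psi(0) E by O(eps). *)
Lemma osc_limit_dominated m (Fa Fb : (R -> Prop) -> Prop) {FFa : ProperFilter Fa} {FFb : ProperFilter Fb}
  (D : R -> Prop) (la lb C lam th : R) (f : R -> R) :
  filter_prod Fa Fb (fun ab : R * R => fst ab <= snd ab) ->
  (forall x y z, D x -> D z -> x <= y <= z -> D y) ->
  Fa D -> Fb D -> (forall x, D x -> 0 < x) ->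
  filterlim atan Fa (locally la) -> filterlim atan Fb (locally lb) ->
  (forall x, D x -> continuous f x) ->
  (forall x, D x -> Rabs (f x) <= C / (1 + x ^ 2)) ->
  (forall x, D x -> x * Rabs (f x) <= C / (1 + x ^ 2)) ->
  exists E, Rabs E <= C * (lb - la) /\
    forall n psi, rapid (S n) psi -> osc_limit m Fa Fb lam th f psi (psi 0 * E).
Proof.
  intros Hle HD Ha Hb Hpos Hla Hlb Hc H0 H1.
  assert (HX : forall g K, (forall x, D x -> continuous g x) ->
     (forall x, D x -> Rabs (g x) <= K) ->
     exists l : R, is_RInt_gen (fun x => cos (lam * x ^ m + th) * (f x * g x)) Fa Fb l).
  { intros g K Hgc Hg. apply (RInt_gen_dominated _ D (C * K) Fa Fb la lb); auto.
    - intros x Hx. apply (cont_mult _ (fun x => f x * g x)); [apply continuous_phase|apply cont_mult; auto].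
    - intros x Hx. rewrite Rabs_mult, (Rabs_mult (f x)).
      apply Rle_trans with (1 * (C / (1 + x ^ 2) * K)); [|right; field; nra].
      apply Rmult_le_compat; try apply Rabs_pos.
      + apply Rmult_le_pos; apply Rabs_pos.
      + apply Rabs_le. apply COS_bound.
      + apply Rmult_le_compat; auto; apply Rabs_pos. }
  destruct (HX (fun _ => 1) 1) as [E HE].
  { intros; apply continuous_const. } { intros; rewrite Rabs_R1; lra. }
  exists E. split.
  { apply (is_RInt_gen_dominated_le _ D C Fa Fb la lb E Hle HD Ha Hb Hla Hlb) in HE; auto.
    intros x Hx. rewrite Rmult_1_r, Rabs_mult. rewrite <- (Rmult_1_l (C / _)).
    apply Rmult_le_compat; try apply Rabs_pos; auto. apply Rabs_le, COS_bound. }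
  intros n psi Hpsi.
  pose proof (rapid_continuous _ _ Hpsi) as Hpc.
  destruct (rapid_Lipschitz _ _ Hpsi) as [M [HM HLip]].
  destruct (rapid_bound _ _ Hpsi O) as [K HK].
  (* The limit needs the integral as a function of [eps]; it is chosen pointwise, with the default
     value 0 where [eps] is not positive. *)
  assert (HJ : forall eps, exists J, 0 < eps ->
     is_RInt_gen (fun x => cos (lam * x ^ m + th) * (f x * psi (eps * x))) Fa Fb J).
  { intros eps. destruct (Rlt_dec 0 eps) as [He|He]; [|exists 0; tauto].
    destruct (HX (fun x => psi (eps * x)) K) as [J HJ]; [| |exists J; auto].
    - intros x _. apply continuous_dilation. auto.
    - intros x Hx. specialize (HK (eps * x)). simpl in HK. pose proof (Hpos x Hx).
      rewrite Rmult_1_l in HK. apply HK. nra. }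
  exists (fun eps => proj1_sig (constructive_indefinite_description _ (HJ eps))).
  split.
  { intros eps He. destruct (constructive_indefinite_description _ (HJ eps)) as [J H]. simpl. auto. }
  apply filterlim_Rabs_lt; [typeclasses eauto|]. intros d Hd.
  set (A := M * C * (lb - la)).
  assert (HdA : 0 < d / (Rabs A + 1)). { apply Rdiv_lt_0_compat; auto. pose proof (Rabs_pos A); lra. }
  exists (mkposreal _ HdA). intros eps Hball He.
  assert (Heps : eps < d / (Rabs A + 1)).
  { change (Rabs (eps - 0) < d / (Rabs A + 1)) in Hball. rewrite Rminus_0_r, Rabs_pos_eq in Hball; lra. }
  destruct (constructive_indefinite_description _ (HJ eps)) as [J HJe]; simpl. specialize (HJe He).
  assert (HB : Rabs (J - psi 0 * E) <= eps * (M * C) * (lb - la)).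
  { apply (is_RInt_gen_dominated_le
      (fun x => cos (lam * x ^ m + th) * (f x * (psi (eps * x) - psi 0))) D _ Fa Fb la lb); auto.
    - intros x Hx. pose proof (Hpos x Hx).
      rewrite Rabs_mult, Rabs_mult.
      apply Rle_trans with (1 * (Rabs (f x) * (M * (eps * x)))).
      + apply Rmult_le_compat; try apply Rabs_pos.
        * apply Rmult_le_pos; apply Rabs_pos.
        * apply Rabs_le, COS_bound.
        * apply Rmult_le_compat_l; [apply Rabs_pos|apply HLip; nra].
      + replace (1 * (Rabs (f x) * (M * (eps * x)))) with (eps * M * (x * Rabs (f x))) by ring.
        replace (eps * (M * C) / (1 + x ^ 2)) with (eps * M * (C / (1 + x ^ 2))) by (field; nra).
        apply Rmult_le_compat_l; [nra|auto].
    - apply (is_RInt_gen_ext (V := R_NormedModule) (fun x =>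
        minus (cos (lam * x ^ m + th) * (f x * psi (eps * x)))
              (scal (psi 0) (cos (lam * x ^ m + th) * (f x * 1))))).
      + apply filter_forall. intros ab x _. unfold minus, plus, opp, scal; simpl. unfold mult; simpl. ring.
      + apply (is_RInt_gen_minus (V := R_NormedModule)); auto.
        apply (is_RInt_gen_scal (V := R_NormedModule)); auto. }
  apply Rle_lt_trans with (1 := HB).
  replace (eps * (M * C) * (lb - la)) with (eps * A) by (unfold A; ring).
  apply Rle_lt_trans with (eps * Rabs A); [apply Rmult_le_compat_l; [lra|apply Rle_abs]|].
  apply Rle_lt_trans with (eps * (Rabs A + 1)); [nra|].
  pose proof (Rabs_pos A).
  apply (Rmult_lt_compat_r (Rabs A + 1)) in Heps; [|lra].
  replace (d / (Rabs A + 1) * (Rabs A + 1)) with d in Heps by (field; lra). exact Heps.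
Qed.

Lemma pow_Rpower_opp (d : nat) (x : R) : 0 < x -> x ^ d * Rpower x (- INR d) = 1.
Proof. intros Hx. rewrite <- Rpower_pow by auto. rewrite <- Rpower_plus, Rplus_opp_r. apply Rpower_O; auto. Qed.

(** One integration by parts, with d = m - 1, after division by the derivative of the phase.
    Rewriting eps psi'(eps x) as x^(-1) times the dilation of t psi'(t) is what returns an integral
    of the same family at the same scale eps. [B eps] is the boundary value at the lower end; at
    infinity the cutoff kills it. *)
Lemma osc_limit_parts (d : nat) (Fa : (R -> Prop) -> Prop) {FFa : ProperFilter Fa}
  (lam th tau C : R) (f u' psi psi' : R -> R) (B : R -> R) (B0 E1 E2 : R) :
  0 < lam -> Fa (fun x => 0 < x) ->
  (forall x, 0 < x -> is_derive (fun x => Rpower x (- INR d) * f x) x (u' x)) ->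
  (forall x, 0 < x -> continuous u' x) ->
  (forall x, 1 <= x -> Rabs (Rpower x (- INR d) * f x) <= C * Rpower x tau) ->
  rapid 0 psi -> (forall t, is_derive psi t (psi' t)) -> (forall t, continuous psi' t) ->
  (forall eps, 0 < eps ->
     filterlim (fun x => sin (lam * x ^ S d + th) * (Rpower x (- INR d) * f x) * psi (eps * x))
               Fa (locally (B eps))) ->
  filterlim B (at_right 0) (locally B0) ->
  osc_limit (S d) Fa (Rbar_locally p_infty) lam (th - PI / 2) u' psi E1 ->
  osc_limit (S d) Fa (Rbar_locally p_infty) lam (th - PI / 2)
    (fun x => Rpower x (- INR (S d)) * f x) (fun t => t * psi' t) E2 ->
  osc_limit (S d) Fa (Rbar_locally p_infty) lam th f psi ((- B0 - E1 - E2) / (lam * INR (S d))).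
Proof.
  intros Hlam Hpos Hu Hu'c Hub Hrap Hpsi Hpsic HB HB0 [J1 [H1 L1]] [J2 [H2 L2]].
  assert (Hm : 0 < INR (S d)) by (apply lt_0_INR; lia).
  set (u := fun x => Rpower x (- INR d) * f x) in *.
  exists (fun e => / (lam * INR (S d)) * (- B e - J1 e - J2 e)). split.
  - intros eps He.
    set (V := fun x => sin (lam * x ^ S d + th) * u x * psi (eps * x)).
    set (V' := fun x => lam * INR (S d) * x ^ d * cos (lam * x ^ S d + th) * u x * psi (eps * x)
              + sin (lam * x ^ S d + th) * u' x * psi (eps * x)
              + sin (lam * x ^ S d + th) * u x * (eps * psi' (eps * x))).
    assert (HV : forall x, 0 < x -> is_derive V x (V' x)).
    { intros x Hx. unfold V, V'. auto_derive.
      - repeat split; auto; [exists (u' x); apply Hu; auto|eexists; apply Hpsi].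
      - replace (Derive (fun x => u x) x) with (u' x) by (symmetry; apply is_derive_unique; auto).
        replace (Derive (fun x => psi x) (eps * x)) with (psi' (eps * x)) by (symmetry; apply is_derive_unique; auto).
        rewrite S_INR; simpl pow; change (match d with O => 1 | S _ => INR d + 1 end) with (INR (S d)); rewrite S_INR; ring. }
    assert (Hseg : filter_prod Fa (Rbar_locally p_infty) (fun ab : R * R =>
      forall x, Rmin (fst ab) (snd ab) <= x <= Rmax (fst ab) (snd ab) -> 0 < x)).
    { apply (filter_prod_segment Fa (Rbar_locally p_infty) (fun x => 0 < x)); auto.
      - intros x y z Hx Hz Hy; lra.
      - exists 0; auto. }
    assert (HDer : is_RInt_gen (Derive V) Fa (Rbar_locally p_infty) (0 - B eps)).
    { apply is_RInt_gen_Derive; try typeclasses eauto.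
      - eapply filter_imp; [|exact Hseg]. intros ab H x Hx. exists (V' x). auto.
      - eapply filter_imp; [|exact Hseg]. intros ab H x Hx.
        assert (Hx0 : 0 < x) by auto.
        apply (continuous_ext_loc _ V').
        + exists (mkposreal x Hx0). intros y Hy. symmetry. apply is_derive_unique. apply HV.
          change (Rabs (y - x) < x) in Hy. apply Rabs_lt_between' in Hy. lra.
        + assert (Cu : continuous u x) by (apply (is_derive_cont _ _ _ (Hu x Hx0))).
          assert (Cp : continuous (fun x => psi (eps * x)) x)
            by (apply continuous_dilation; apply (is_derive_cont _ _ _ (Hpsi _))).
          assert (Cp' : continuous (fun x => psi' (eps * x)) x) by (apply continuous_dilation; auto).
          assert (Cs : continuous (fun x => sin (lam * x ^ S d + th)) x)
            by (apply (ex_derive_continuous (fun x => sin (lam * x ^ S d + th))); auto_derive; trivial).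
          assert (Cc : continuous (fun x => lam * INR (S d) * x ^ d * cos (lam * x ^ S d + th)) x)
            by (apply (ex_derive_continuous (fun x => lam * INR (S d) * x ^ d * cos (lam * x ^ S d + th))); auto_derive; trivial).
          unfold V'.
          apply (continuous_plus (fun x => lam * INR (S d) * x ^ d * cos (lam * x ^ S d + th) * u x * psi (eps * x)
              + sin (lam * x ^ S d + th) * u' x * psi (eps * x)) (fun x => sin (lam * x ^ S d + th) * u x * (eps * psi' (eps * x)))).
          * apply (continuous_plus (fun x => lam * INR (S d) * x ^ d * cos (lam * x ^ S d + th) * u x * psi (eps * x))).
            -- apply cont_mult; auto. apply (cont_mult (fun x => lam * INR (S d) * x ^ d * cos (lam * x ^ S d + th))); auto.
            -- apply cont_mult; auto. apply cont_mult; auto.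
          * apply cont_mult; [apply cont_mult; auto|]. apply cont_mult; auto. apply continuous_const.
      - apply HB; auto.
      - apply (filterlim_ext_loc V). { exists 0; intros; reflexivity. }
        (* The boundary term at infinity: |u| grows at most like x^(k+1), and the decay of the
           cutoff is used with the power k+2, which leaves a factor 1/x. *)
        destruct (nfloor_ex (Rabs tau) (Rabs_pos tau)) as [k [_ Hk]].
        destruct (rapid_bound _ _ Hrap (S (S k))) as [M HM].
        assert (HC0 : 0 <= C).
        { specialize (Hub 1 ltac:(lra)). pose proof (Rabs_pos (Rpower 1 (- INR d) * f 1)). pose proof (Rpower_pos 1 tau).
          destruct (Rle_dec 0 C); auto. nra. }
        assert (He2 : 0 < / eps ^ S (S k)) by (apply Rinv_0_lt_compat, pow_lt; auto).
        set (A := C * M * / eps ^ S (S k)).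
        apply filterlim_Rabs_lt; [typeclasses eauto|]. intros e0 He0.
        exists (Rmax 1 (Rabs A / e0)). intros x Hx.
        assert (Hx1 : 1 < x) by (apply Rle_lt_trans with (2 := Hx), Rmax_l).
        assert (HxA : Rabs A / e0 < x) by (apply Rle_lt_trans with (2 := Hx), Rmax_r).
        rewrite Rminus_0_r. unfold V. rewrite !Rabs_mult.
        assert (Hs : Rabs (sin (lam * x ^ S d + th)) <= 1) by (apply Rabs_le, SIN_bound).
        assert (Hu2 : Rabs (u x) <= C * x ^ S k).
        { apply Rle_trans with (1 := Hub x ltac:(lra)). apply Rmult_le_compat_l; auto.
          rewrite <- Rpower_pow by lra. apply Rpower_le_exp; [lra|]. rewrite S_INR. pose proof (Rle_abs tau); lra. }
        assert (Hp2 : x ^ S (S k) * Rabs (psi (eps * x)) <= M * / eps ^ S (S k)).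
        { specialize (HM (eps * x) ltac:(nra)). rewrite Rpow_mult_distr in HM.
          apply (Rmult_le_reg_l (eps ^ S (S k))); [apply pow_lt; auto|].
          replace (eps ^ S (S k) * (M * / eps ^ S (S k))) with M; [lra|]. field. apply pow_nonzero; lra. }
        assert (Hfin : Rabs (u x) * Rabs (psi (eps * x)) * x <= A).
        { apply Rle_trans with (C * x ^ S k * Rabs (psi (eps * x)) * x).
          - apply Rmult_le_compat_r; [lra|]. apply Rmult_le_compat_r; [apply Rabs_pos|auto].
          - replace (C * x ^ S k * Rabs (psi (eps * x)) * x) with (C * (x ^ S (S k) * Rabs (psi (eps * x)))) by (simpl; ring).
            unfold A. rewrite Rmult_assoc. apply Rmult_le_compat_l; auto. }
        set (P := Rabs (u x) * Rabs (psi (eps * x))) in *.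
        assert (0 <= P) by (apply Rmult_le_pos; apply Rabs_pos).
        rewrite Rmult_assoc. fold P.
        apply Rle_lt_trans with P; [pose proof (Rabs_pos (sin (lam * x ^ S d + th))); nra|].
        apply (Rmult_lt_reg_r x); [lra|]. apply Rle_lt_trans with (1 := Hfin).
        apply Rle_lt_trans with (1 := Rle_abs A).
        apply (Rmult_lt_compat_r e0) in HxA; auto.
        replace (Rabs A / e0 * e0) with (Rabs A) in HxA by (field; lra). lra. }
    apply (is_RInt_gen_ext (V := R_NormedModule) (fun x => scal (/ (lam * INR (S d)))
      (minus (minus (Derive V x) (cos (lam * x ^ S d + (th - PI / 2)) * (u' x * psi (eps * x))))
        (cos (lam * x ^ S d + (th - PI / 2)) * ((Rpower x (- INR (S d)) * f x) * (eps * x * psi' (eps * x))))))).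
    + eapply filter_imp; [|exact Hseg]. intros ab H x Hx.
      assert (Hx0 : 0 < x) by (apply H; lra).
      rewrite (is_derive_unique V x (V' x)) by auto.
      replace (lam * x ^ S d + (th - PI / 2)) with (- (PI / 2 - (lam * x ^ S d + th))) by ring.
      rewrite cos_neg, cos_shift.
      unfold minus, plus, opp, scal.
      change (/ (lam * INR (S d)) * (V' x + - (sin (lam * x ^ S d + th) * (u' x * psi (eps * x))) +
         - (sin (lam * x ^ S d + th) * (Rpower x (- INR (S d)) * f x * (eps * x * psi' (eps * x))))) =
         cos (lam * x ^ S d + th) * (f x * psi (eps * x))).
      unfold V', u. pose proof (pow_Rpower_opp d x Hx0) as K1.
      assert (K2 : Rpower x (- INR (S d)) * x = Rpower x (- INR d)).
      { rewrite S_INR. rewrite <- (Rpower_1 x Hx0) at 2. rewrite <- Rpower_plus. f_equal; ring. }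
      rewrite <- K2. rewrite <- K2 in K1.
      apply (Rmult_eq_reg_l (lam * INR (S d))); [|nra].
      rewrite <- Rmult_assoc, Rinv_r, Rmult_1_l by nra.
      transitivity (lam * INR (S d) * cos (lam * x ^ S d + th) * f x * psi (eps * x) * (x ^ d * (Rpower x (- INR (S d)) * x))); [ring|].
      rewrite K1. ring.
    + replace (/ (lam * INR (S d)) * (- B eps - J1 eps - J2 eps)) with
        (scal (/ (lam * INR (S d))) (minus (minus (0 - B eps) (J1 eps)) (J2 eps)))
        by (unfold minus, plus, opp, scal; simpl; unfold mult; simpl; ring).
      apply (is_RInt_gen_scal (V := R_NormedModule)).
      apply (is_RInt_gen_minus (V := R_NormedModule)); [apply (is_RInt_gen_minus (V := R_NormedModule))|]; auto.
  - replace ((- B0 - E1 - E2) / (lam * INR (S d))) with (/ (lam * INR (S d)) * (- B0 - E1 - E2)) by (unfold Rdiv; ring).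
    apply (filterlim_comp _ _ _ (fun e => - B e - J1 e - J2 e) (fun y => / (lam * INR (S d)) * y) _ (locally (- B0 - E1 - E2)));
      [|apply (filterlim_scal_r (V := R_NormedModule))].
    apply (filterlim_comp_2 (fun e => - B e - J1 e) (fun e => - J2 e) Rplus (G := locally (- B0 - E1)) (H := locally (- E2)));
      [| |apply (filterlim_plus (V := R_NormedModule))].
    + apply (filterlim_comp_2 (fun e => - B e) (fun e => - J1 e) Rplus (G := locally (- B0)) (H := locally (- E1)));
      [| |apply (filterlim_plus (V := R_NormedModule))].
      * apply (filterlim_comp _ _ _ B Ropp _ (locally B0)); auto. apply (filterlim_opp (V := R_NormedModule)).
      * apply (filterlim_comp _ _ _ J1 Ropp _ (locally E1)); auto. apply (filterlim_opp (V := R_NormedModule)).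
    + apply (filterlim_comp _ _ _ J2 Ropp _ (locally E2)); auto. apply (filterlim_opp (V := R_NormedModule)).
Qed.

(** Both amplitudes produced by an integration by parts are put in one class, so that a single
    induction hypothesis serves them: x^(-m) f has order tau - d - 1 at infinity, which is at most
    tau - d + delta. At 0 each loses m, hence the requirement of vanishing to order n m for n
    steps. *)
Lemma symbol_parts delta n (d : nat) J tau f : -1 <= delta -> symbol delta (S n) J tau f ->
  exists u', (forall x, 0 < x -> is_derive (fun x => Rpower x (- INR d) * f x) x (u' x)) /\
    symbol delta n (J - INR (S d)) (tau - INR d + delta) u' /\
    symbol delta n (J - INR (S d)) (tau - INR d + delta) (fun x => Rpower x (- INR (S d)) * f x).
Proof.
  intros Hd Hf.
  pose proof (symbol_Rpower delta (S n) Hd (- INR d) J tau f Hf) as [_ [u' [H1 H2]]].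
  exists u'. split; [exact H1|]. rewrite S_INR. split.
  - replace (J - (INR d + 1)) with (J + - INR d - 1) by ring. exact H2.
  - apply symbol_pred in Hf.
    pose proof (symbol_Rpower delta n Hd (- INR (S d)) J tau f Hf) as H3. rewrite S_INR in H3.
    apply (symbol_mono _ _ _ _ _ _ _) with (3 := H3); lra.
Qed.

Lemma filterlim_at_right_cont (B : R -> R) (l : R) :
  continuous B 0 -> B 0 = l -> filterlim B (at_right 0) (locally l).
Proof. intros H <-. apply continuous_at_right. exact H. Qed.

(** [n] integrations by parts bring the order down to -3, where even x |f| is dominated by a
    multiple of 1/(1+x^2). Starting at 1 keeps away from the singular powers of x at 0; the boundary
    terms at 1 are divided by lam, so [E] stays bounded for lam >= 1, uniformly in [th]. *)
Lemma osc_limit_at_infinity (d : nat) (delta : R) (n : nat) :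
  -1 <= delta < INR d -> forall J tau f, symbol delta n J tau f ->
  tau <= -3 + INR n * (INR d - delta) ->
  exists C, 0 <= C /\ forall lam th, 0 < lam -> exists E, (1 <= lam -> Rabs E <= C) /\
    forall psi, rapid (S n) psi ->
      osc_limit (S d) (at_point 1) (Rbar_locally p_infty) lam th f psi (psi 0 * E).
Proof.
  intros Hd. induction n; intros J tau f Hf Htau.
  - simpl INR in Htau. rewrite Rmult_0_l, Rplus_0_r in Htau.
    destruct (symbol_bound _ _ _ _ _ Hf) as [C [HC HfC]].
    assert (Hx3 : forall x, 1 <= x -> Rabs (f x) <= C * / x ^ 3).
    { intros x Hx. apply Rle_trans with (1 := HfC x ltac:(lra)). apply Rmult_le_compat_l; [lra|].
      apply Rle_trans with (Rpower x (-3)).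
      - unfold weight. destruct (Rle_dec x 1) as [Hx1|Hx1].
        + replace x with 1 by lra. unfold Rpower. rewrite ln_1, !Rmult_0_r. lra.
        + apply Rpower_le_exp; auto; lra.
      - right. replace (-3) with (- INR 3) by (simpl; ring). rewrite Rpower_Ropp, Rpower_pow by lra. reflexivity. }
    assert (Hx2 : forall x, 1 <= x -> x * Rabs (f x) <= 2 * C / (1 + x ^ 2)).
    { intros x Hx. apply Rle_trans with (x * (C * / x ^ 3)).
      - apply Rmult_le_compat_l; [lra|auto].
      - apply (Rmult_le_reg_r (x ^ 2 * (1 + x ^ 2))); [nra|].
        replace (x * (C * / x ^ 3) * (x ^ 2 * (1 + x ^ 2))) with (C * (1 + x ^ 2)) by (field; lra).
        replace (2 * C / (1 + x ^ 2) * (x ^ 2 * (1 + x ^ 2))) with (C * (2 * x ^ 2)) by (field; nra).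
        apply Rmult_le_compat_l; nra. }
    exists (2 * C * (PI / 2 - atan 1)). split.
    { assert (H := atan_bound 1). pose proof PI_RGT_0. nra. }
    intros lam th Hlam.
    destruct (osc_limit_dominated (S d) (at_point 1) (Rbar_locally p_infty) (fun x => 1 <= x) (atan 1) (PI / 2)
      (2 * C) lam th f) as [E [HE1 HE2]].
    + apply (Filter_prod _ _ _ (fun x => x = 1) (fun x => 1 < x)); [reflexivity|exists 1; auto|].
      simpl; intros; lra.
    + intros; lra.
    + unfold at_point; lra.
    + exists 1; intros; lra.
    + intros; lra.
    + apply at_point_lim.
    + apply atan_lim_p_infty.
    + intros x Hx. apply (symbol_continuous _ _ _ _ _ Hf). lra.
    + intros x Hx. apply Rle_trans with (2 := Hx2 x Hx). pose proof (Rabs_pos (f x)); nra.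
    + exact Hx2.
    + exists E. split; [auto|]. intros psi Hpsi; apply (HE2 O); exact Hpsi.
  - destruct (symbol_parts _ _ d _ _ _ (proj1 Hd) Hf) as [u' [Hu [Hs1 Hs2]]].
    assert (Ht : tau - INR d + delta <= -3 + INR n * (INR d - delta)) by (rewrite S_INR in Htau; lra).
    destruct (IHn _ _ _ Hs1 Ht) as [C1 [HC1 H1]]. destruct (IHn _ _ _ Hs2 Ht) as [C2 [HC2 H2]].
    assert (Hm : 1 <= INR (S d)) by (rewrite S_INR; pose proof (pos_INR d); lra).
    set (u1 := Rpower 1 (- INR d) * f 1).
    exists (Rabs u1 + C1). split; [pose proof (Rabs_pos u1); lra|].
    intros lam th Hlam.
    destruct (H1 lam (th - PI / 2) Hlam) as [E1 [HE1 O1]].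
    destruct (H2 lam (th - PI / 2) Hlam) as [E2 [HE2 O2]].
    exists ((- (sin (lam * 1 ^ S d + th) * u1) - E1) / (lam * INR (S d))). split.
    + intros Hl. specialize (HE1 Hl). unfold Rdiv. rewrite Rabs_mult, (Rabs_pos_eq (/ _)).
      * apply Rle_trans with (Rabs (- (sin (lam * 1 ^ S d + th) * u1) - E1) * 1).
        -- apply Rmult_le_compat_l; [apply Rabs_pos|]. rewrite <- Rinv_1. apply Rinv_le_contravar; nra.
        -- rewrite Rmult_1_r. eapply Rle_trans; [apply Rabs_triang|]. rewrite !Rabs_Ropp, Rabs_mult.
           assert (Rabs (sin (lam * 1 ^ S d + th)) <= 1) by (apply Rabs_le, SIN_bound).
           pose proof (Rabs_pos u1). nra.
      * left; apply Rinv_0_lt_compat; nra.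
    + intros psi Hpsi.
      pose proof (rapid_pred _ _ Hpsi) as Hpsi1.
      pose proof (rapid_continuous _ _ Hpsi) as Hpc.
      assert (Hp0 : rapid 0 psi) by (split; auto; apply (rapid_bound _ _ Hpsi)).
      destruct Hpsi as [_ [psi' [Hder Hpsi']]].
      pose proof (O1 psi Hpsi1) as K1. pose proof (O2 _ (rapid_mult_id _ _ Hpsi')) as K2.
      destruct (symbol_bound _ _ _ _ _ (symbol_Rpower delta (S n) (proj1 Hd) (- INR d) J tau f Hf)) as [C [HC HfC]].
      (* The factor [0 * psi' 0] is the value at 0 of the new cutoff t psi'(t), which is why [E2]
         does not enter the limit. *)
      replace (psi 0 * ((- (sin (lam * 1 ^ S d + th) * u1) - E1) / (lam * INR (S d))))
        with ((- (sin (lam * 1 ^ S d + th) * u1 * psi 0) - psi 0 * E1 - 0 * psi' 0 * E2) / (lam * INR (S d)))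
        by (field; split; nra).
      apply (osc_limit_parts d (at_point 1) lam th (Rmax (J + - INR d) (tau + - INR d)) C f u' psi psi'
        (fun eps => sin (lam * 1 ^ S d + th) * u1 * psi (eps * 1))); auto.
      * unfold at_point; lra.
      * apply (symbol_continuous _ _ _ _ _ Hs1).
      * intros x Hx. apply Rle_trans with (1 := HfC x ltac:(lra)). apply Rmult_le_compat_l; [lra|].
        unfold weight. destruct (Rle_dec x 1); apply Rpower_le_exp; auto; [apply Rmax_l|apply Rmax_r].
      * apply (rapid_continuous _ _ Hpsi').
      * intros eps He. apply (at_point_lim (fun x => sin (lam * x ^ S d + th) * (Rpower x (- INR d) * f x) * psi (eps * x)) 1).
      * apply filterlim_at_right_cont; [|rewrite Rmult_0_l; auto].
        apply (cont_mult (fun _ => sin (lam * 1 ^ S d + th) * u1) (fun eps => psi (eps * 1))).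
        -- apply continuous_const.
        -- apply (continuous_comp (fun e => e * 1) psi); auto.
           apply (ex_derive_continuous (fun e => e * 1)). auto_derive; trivial.
Qed.

(** [n] counts the integrations by parts over the whole half-line, each of which gains a factor
    1/lam; [N] counts the further ones that only serve convergence and are carried out on [1,
    infinity). When n = 0 the amplitude is bounded near 0, and the half-line is split at 1. *)
Lemma osc_limit_half_line (d : nat) (delta : R) (n : nat) :
  -1 <= delta < INR d -> forall N tau f, symbol delta (n + N) (INR n * INR (S d)) tau f ->
  tau <= -3 + INR (n + N) * (INR d - delta) ->
  exists C, 0 <= C /\ forall lam th, 0 < lam -> exists E, (1 <= lam -> Rabs E <= C * / lam ^ n) /\
    forall psi, rapid (S (n + N)) psi ->
      osc_limit (S d) (at_right 0) (Rbar_locally p_infty) lam th f psi (psi 0 * E).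
Proof.
  intros Hd. induction n; intros N tau f Hf Htau.
  - simpl (0 + N)%nat in *.
    destruct (osc_limit_at_infinity d delta N Hd _ _ _ Hf Htau) as [C1 [HC1 H1]].
    destruct (symbol_bound _ _ _ _ _ Hf) as [C [HC HfC]].
    assert (HfC' : forall x, 0 < x <= 1 -> Rabs (f x) <= 2 * C / (1 + x ^ 2)).
    { intros x Hx. apply Rle_trans with (1 := HfC x ltac:(lra)).
      unfold weight. destruct (Rle_dec x 1); [|lra]. simpl INR. rewrite Rmult_0_l, Rpower_O by lra.
      apply (Rmult_le_reg_r (1 + x ^ 2)); [nra|].
      replace (2 * C / (1 + x ^ 2) * (1 + x ^ 2)) with (2 * C) by (field; nra).
      assert (x ^ 2 <= 1) by nra. nra. }
    exists (2 * C * atan 1 + C1). split.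
    { assert (0 < atan 1) by (rewrite <- atan_0; apply atan_increasing; lra). nra. }
    intros lam th Hlam.
    destruct (H1 lam th Hlam) as [E1 [HE1 O1]].
    destruct (osc_limit_dominated (S d) (at_right 0) (at_point 1) (fun x => 0 < x <= 1) (atan 0) (atan 1)
      (2 * C) lam th f) as [E [HE2 O2]].
    + apply (Filter_prod _ _ _ (fun x => x < 1) (fun x => x = 1)); [|reflexivity|simpl; intros; lra].
      exists (mkposreal 1 Rlt_0_1). intros y Hy _. change (Rabs (y - 0) < 1) in Hy.
      rewrite Rminus_0_r in Hy. apply Rabs_lt_between in Hy; lra.
    + intros; lra.
    + exists (mkposreal 1 Rlt_0_1). intros y Hy Hy0. change (Rabs (y - 0) < 1) in Hy.
      rewrite Rminus_0_r in Hy. apply Rabs_lt_between in Hy; lra.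
    + unfold at_point; lra.
    + intros; lra.
    + apply atan_lim_right.
    + apply at_point_lim.
    + intros x Hx. apply (symbol_continuous _ _ _ _ _ Hf). lra.
    + exact HfC'.
    + intros x Hx. apply Rle_trans with (2 := HfC' x Hx). pose proof (Rabs_pos (f x)); nra.
    + exists (E + E1). split.
      * intros Hl. specialize (HE1 Hl). rewrite atan_0, Rminus_0_r in HE2.
        simpl pow. rewrite Rinv_1, Rmult_1_r. pose proof (Rabs_triang E E1). lra.
      * intros psi Hpsi. rewrite Rmult_plus_distr_l. apply (osc_limit_Chasles (S d) (at_right 0) (Rbar_locally p_infty) 1);
          [apply (O2 N); exact Hpsi|apply O1; exact Hpsi].
  - change (S n + N)%nat with (S (n + N)) in *.
    destruct (symbol_parts _ _ d _ _ _ (proj1 Hd) Hf) as [u' [Hu [Hs1 Hs2]]].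
    assert (HJ : INR (S n) * INR (S d) - INR (S d) = INR n * INR (S d)) by (rewrite (S_INR n); ring).
    rewrite HJ in Hs1, Hs2.
    assert (Ht : tau - INR d + delta <= -3 + INR (n + N) * (INR d - delta)) by (rewrite S_INR in Htau; lra).
    destruct (IHn _ _ _ Hs1 Ht) as [C1 [HC1 H1]]. destruct (IHn _ _ _ Hs2 Ht) as [C2 [HC2 H2]].
    assert (Hm : 1 <= INR (S d)) by (rewrite S_INR; pose proof (pos_INR d); lra).
    exists C1. split; auto.
    intros lam th Hlam.
    destruct (H1 lam (th - PI / 2) Hlam) as [E1 [HE1 O1]].
    destruct (H2 lam (th - PI / 2) Hlam) as [E2 [HE2 O2]].
    exists (- E1 / (lam * INR (S d))). split.
    + intros Hl. specialize (HE1 Hl). unfold Rdiv. rewrite Rabs_mult, Rabs_Ropp, (Rabs_pos_eq (/ _)).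
      * replace (C1 * / lam ^ S n) with (C1 * / lam ^ n * / lam)
          by (simpl; field; split; try apply pow_nonzero; lra).
        apply Rmult_le_compat; auto; [apply Rabs_pos|left; apply Rinv_0_lt_compat; nra|].
        apply Rinv_le_contravar; nra.
      * left; apply Rinv_0_lt_compat; nra.
    + intros psi Hpsi.
      pose proof (rapid_pred _ _ Hpsi) as Hpsi1.
      pose proof (rapid_continuous _ _ Hpsi) as Hpc.
      assert (Hp0 : rapid 0 psi) by (split; auto; apply (rapid_bound _ _ Hpsi)).
      destruct (rapid_bound _ _ Hpsi O) as [K HK].
      destruct Hpsi as [_ [psi' [Hder Hpsi']]].
      pose proof (O1 psi Hpsi1) as K1. pose proof (O2 _ (rapid_mult_id _ _ Hpsi')) as K2.
      destruct (symbol_bound _ _ _ _ _ (symbol_Rpower delta (S (n + N)) (proj1 Hd) (- INR d) _ tau f Hf)) as [C [HC HfC]].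
      replace (psi 0 * (- E1 / (lam * INR (S d))))
        with ((- 0 - psi 0 * E1 - 0 * psi' 0 * E2) / (lam * INR (S d)))
        by (field; split; nra).
      apply (osc_limit_parts d (at_right 0) lam th
        (Rmax (INR (S n) * INR (S d) + - INR d) (tau + - INR d)) C f u' psi psi' (fun eps => 0)); auto.
      * exists (mkposreal 1 Rlt_0_1); auto.
      * apply (symbol_continuous _ _ _ _ _ Hs1).
      * intros x Hx. apply Rle_trans with (1 := HfC x ltac:(lra)). apply Rmult_le_compat_l; [lra|].
        unfold weight. destruct (Rle_dec x 1); apply Rpower_le_exp; auto; [apply Rmax_l|apply Rmax_r].
      * apply (rapid_continuous _ _ Hpsi').
      * intros eps He. apply filterlim_Rabs_lt; [typeclasses eauto|]. intros e He0.
        assert (HK0 : 0 <= K).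
        { specialize (HK 0 (Rle_refl 0)). pose proof (Rabs_pos (psi 0)). simpl in HK. lra. }
        assert (HCK : 0 < e / (C * K + 1)) by (apply Rdiv_lt_0_compat; nra).
        assert (Hmin : 0 < Rmin 1 (e / (C * K + 1))) by (apply Rmin_pos; lra).
        exists (mkposreal _ Hmin). intros x Hx Hx0.
        change (Rabs (x - 0) < Rmin 1 (e / (C * K + 1))) in Hx.
        rewrite Rminus_0_r, Rabs_pos_eq in Hx by lra.
        assert (x < 1) by (apply Rlt_le_trans with (1 := Hx), Rmin_l).
        assert (Hxe : x < e / (C * K + 1)) by (apply Rlt_le_trans with (1 := Hx), Rmin_r).
        rewrite Rminus_0_r, Rmult_assoc, Rabs_mult, (Rabs_mult (Rpower x (- INR d) * f x)).
        assert (Rabs (sin (lam * x ^ S d + th)) <= 1) by (apply Rabs_le, SIN_bound).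
        (* The boundary term vanishes at 0 with one power to spare: (n+1) m - d = n m + 1 >= 1. *)
        assert (Hux : Rabs (Rpower x (- INR d) * f x) <= C * x).
        { apply Rle_trans with (1 := HfC x ltac:(lra)). apply Rmult_le_compat_l; [lra|].
          unfold weight. destruct (Rle_dec x 1); [|lra].
          rewrite <- (Rpower_1 x Hx0) at 2. apply Rpower_le_exp_small; [lra|].
          rewrite !S_INR. pose proof (pos_INR n). pose proof (pos_INR d). nra. }
        assert (Hpx : Rabs (psi (eps * x)) <= K).
        { specialize (HK (eps * x) ltac:(nra)). simpl in HK. lra. }
        assert (Hprod : Rabs (Rpower x (- INR d) * f x) * Rabs (psi (eps * x)) <= C * x * K)
          by (apply Rmult_le_compat; auto; apply Rabs_pos).
        apply (Rmult_lt_compat_r (C * K + 1)) in Hxe; [|nra].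
        replace (e / (C * K + 1) * (C * K + 1)) with e in Hxe by (field; nra).
        apply Rle_lt_trans with (1 * (C * x * K)); [|nra].
        apply Rmult_le_compat; auto; try apply Rabs_pos. apply Rmult_le_pos; apply Rabs_pos.
      * apply filterlim_const.
Qed.

(** * Gamma integrals and contour rotation *)

(** From exp(y/q) >= 1 + y/q follows exp(y) >= (y/q)^q. This is applied to y = r x^(m+1) with q = i
    + 1, which is positive and satisfies (m+1) q >= i, so that x^i <= 1 + x^((m+1) q). *)
Lemma pow_mul_exp_neg_bounded (m i : nat) (r : R) : 0 < r ->
  exists M, 0 <= M /\ forall x, 0 <= x -> x ^ i * exp (- (r * x ^ S m)) <= M.
Proof.
  intros Hr. set (q := S i).
  assert (Hq : 0 < INR q) by (apply lt_0_INR; unfold q; lia).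
  assert (Hexp : forall y, 0 <= y -> y ^ q * exp (- y) <= INR q ^ q).
  { intros y Hy.
    assert (E : exp y = exp (y / INR q) ^ q).
    { rewrite <- Rpower_pow by apply exp_pos. unfold Rpower. rewrite ln_exp. f_equal. field. lra. }
    assert (L : (y / INR q) ^ q <= exp y).
    { rewrite E. apply pow_incr. split; [apply Rdiv_le_0_compat; lra|].
      pose proof (exp_ineq1_le (y / INR q)). lra. }
    rewrite exp_Ropp. apply (Rmult_le_reg_r (exp y)); [apply exp_pos|].
    rewrite Rmult_assoc, Rinv_l, Rmult_1_r by (apply Rgt_not_eq, exp_pos).
    unfold Rdiv in L. rewrite Rpow_mult_distr, pow_inv in L.
    assert (Hp : 0 < INR q ^ q) by (apply pow_lt; auto).
    apply (Rmult_le_compat_l (INR q ^ q)) in L; [|lra].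
    replace (INR q ^ q * (y ^ q * / INR q ^ q)) with (y ^ q) in L by (field; lra). exact L. }
  assert (Hrq : 0 < r ^ q) by (apply pow_lt; auto).
  exists (1 + / r ^ q * INR q ^ q). split.
  { assert (0 < / r ^ q) by (apply Rinv_0_lt_compat; auto). assert (0 < INR q ^ q) by (apply pow_lt; auto). nra. }
  intros x Hx.
  assert (Hy : 0 <= r * x ^ S m) by (apply Rmult_le_pos; [lra|apply pow_le; auto]).
  assert (Hxi : x ^ i <= 1 + / r ^ q * (r * x ^ S m) ^ q).
  { rewrite Rpow_mult_distr, <- Rmult_assoc, Rinv_l, Rmult_1_l by lra. rewrite <- pow_mult.
    destruct (Rle_dec x 1).
    - apply Rle_trans with 1; [rewrite <- (pow1 i); apply pow_incr; lra|].
      pose proof (pow_le x (S m * q) Hx). lra.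
    - apply Rle_trans with (x ^ (S m * q)); [apply Rle_pow; [lra|unfold q; nia]|lra]. }
  pose proof (Hexp _ Hy) as H1.
  assert (exp (- (r * x ^ S m)) <= 1).
  { rewrite <- exp_0. destruct (Rle_lt_or_eq_dec _ _ Hy) as [h|h].
    - left; apply exp_increasing; lra.
    - rewrite <- h, Ropp_0. lra. }
  pose proof (exp_pos (- (r * x ^ S m))).
  apply Rle_trans with ((1 + / r ^ q * (r * x ^ S m) ^ q) * exp (- (r * x ^ S m))).
  - apply Rmult_le_compat_r; lra.
  - rewrite Rmult_plus_distr_r, Rmult_1_l, Rmult_assoc.
    apply Rplus_le_compat; auto. apply Rmult_le_compat_l; auto. left; apply Rinv_0_lt_compat; auto.
Qed.

Lemma is_RInt_gen_lim (f : R -> R) (Fa Fb : (R -> Prop) -> Prop) {FFa : Filter Fa} {FFb : Filter Fb} (l : R) :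
  is_RInt_gen f Fa Fb l ->
  filterlim (fun ab : R * R => RInt f (fst ab) (snd ab)) (filter_prod Fa Fb) (locally l).
Proof.
  intros H P HP. specialize (H P HP). unfold filtermapi in H. unfold filtermap.
  eapply filter_imp; [|exact H]. intros ab [y [Hy HPy]].
  rewrite (is_RInt_unique (V := R_CompleteNormedModule) _ _ _ _ Hy). exact HPy.
Qed.

Lemma segment_pos : filter_prod (at_right 0) (Rbar_locally p_infty) (fun ab : R * R =>
   0 < fst ab <= snd ab /\
   forall x, Rmin (fst ab) (snd ab) <= x <= Rmax (fst ab) (snd ab) -> 0 < x).
Proof.
  apply (Filter_prod _ _ _ (fun x => 0 < x < 1) (fun x => 1 < x)).
  - exists (mkposreal 1 Rlt_0_1). intros y Hy Hy0. change (Rabs (y - 0) < 1) in Hy.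
    rewrite Rminus_0_r in Hy. apply Rabs_lt_between in Hy; lra.
  - exists 1; auto.
  - simpl. intros a b Ha Hb. split; [lra|]. intros x. rewrite Rmin_left by lra. lra.
Qed.

Lemma is_RInt_gen_subst (f g dg : R -> R) (l : R) :
  (forall x, 0 < x -> 0 < g x /\ is_derive g x (dg x) /\ continuous dg x) ->
  (forall x, 0 < x -> continuous f x) ->
  filterlim g (at_right 0) (at_right 0) ->
  filterlim g (Rbar_locally p_infty) (Rbar_locally p_infty) ->
  is_RInt_gen f (at_right 0) (Rbar_locally p_infty) l ->
  is_RInt_gen (fun t => dg t * f (g t)) (at_right 0) (Rbar_locally p_infty) l.
Proof.
  intros Hg Hf Ha Hb H.
  apply (filterlimi_lim_ext_loc (fun ab : R * R => RInt f (g (fst ab)) (g (snd ab)))).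
  - eapply filter_imp; [|exact segment_pos]. intros [a b] [_ Hab]. simpl in *.
    apply (is_RInt_comp (V := R_CompleteNormedModule) f g dg a b).
    + intros x Hx. apply Hf, Hg, Hab, Hx.
    + intros x Hx. apply Hg, Hab, Hx.
  - apply (filterlim_comp _ _ _ (fun ab : R * R => (g (fst ab), g (snd ab)))
      (fun ab : R * R => RInt f (fst ab) (snd ab)) _ (filter_prod (at_right 0) (Rbar_locally p_infty))).
    + apply filterlim_pair.
      * apply (filterlim_comp _ _ _ fst g _ (at_right 0)); auto. apply filterlim_fst.
      * apply (filterlim_comp _ _ _ snd g _ (Rbar_locally p_infty)); auto. apply filterlim_snd.
    + apply is_RInt_gen_lim; auto; typeclasses eauto.
Qed.

Lemma continuous_monomial_exp (j m : nat) (r x : R) :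
  continuous (fun x => x ^ j * exp (- (r * x ^ m))) x.
Proof. apply (ex_derive_continuous (fun x => x ^ j * exp (- (r * x ^ m)))). auto_derive. trivial. Qed.

Lemma ex_monomial_exp_integral (j d : nat) (r : R) : 0 < r ->
  exists l : R, is_RInt_gen (fun x => x ^ j * exp (- (r * x ^ S d))) (at_right 0) (Rbar_locally p_infty) l.
Proof.
  intros Hr.
  destruct (pow_mul_exp_neg_bounded d j r Hr) as [M1 [HM1 H1]].
  destruct (pow_mul_exp_neg_bounded d (S (S j)) r Hr) as [M2 [HM2 H2]].
  apply (RInt_gen_dominated _ (fun x => 0 < x) (M1 + M2) _ _ (atan 0) (PI / 2)).
  - intros; lra.
  - exists (mkposreal 1 Rlt_0_1); auto.
  - exists 0; auto.
  - apply atan_lim_right.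
  - apply atan_lim_p_infty.
  - intros x _. apply continuous_monomial_exp.
  - intros x Hx. specialize (H1 x ltac:(lra)). specialize (H2 x ltac:(lra)).
    rewrite Rabs_pos_eq.
    + apply (Rmult_le_reg_r (1 + x ^ 2)); [nra|].
      replace ((M1 + M2) / (1 + x ^ 2) * (1 + x ^ 2)) with (M1 + M2) by (field; nra).
      simpl pow in *. nra.
    + apply Rmult_le_pos; [apply pow_le; lra|left; apply exp_pos].
Qed.

Lemma Rpower_inv_pow (d : nat) (x : R) : 0 < x -> Rpower x (/ INR (S d)) ^ S d = x.
Proof.
  intros Hx. assert (0 < INR (S d)) by (apply lt_0_INR; lia).
  rewrite <- Rpower_pow by apply Rpower_pos. rewrite Rpower_mult, Rinv_l by lra. apply Rpower_1; auto.
Qed.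

(** The substitution t = r x^m. Convergence is obtained on the side of x, where the integrand is
    bounded near 0, and carried over to Euler's integral, which may be singular there; only then
    does the totally defined [Gamma] receive its value by uniqueness. *)
Lemma monomial_exp_integral (j d : nat) (r : R) : 0 < r ->
  is_RInt_gen (fun x => x ^ j * exp (- (r * x ^ S d))) (at_right 0) (Rbar_locally p_infty)
    (Gamma (INR (S j) / INR (S d)) / INR (S d) * Rpower r (- (INR (S j) / INR (S d)))).
Proof.
  intros Hr. destruct (ex_monomial_exp_integral j d r Hr) as [l Hl].
  set (al := INR (S j) / INR (S d)).
  assert (Hm : 0 < INR (S d)) by (apply lt_0_INR; lia).
  assert (HG : is_RInt_gen (fun t => Rpower t (al - 1) * exp (- t)) (at_right 0) (Rbar_locally p_infty)
    (INR (S d) * Rpower r al * l)).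
  (* [g] is x as a function of t, and [dg] is its derivative. *)
  { set (g := fun t => Rpower (t / r) (/ INR (S d))).
    set (dg := fun t => / INR (S d) * Rpower (t / r) (/ INR (S d) - 1) * / r).
    assert (Hcan : forall t : R, r * (t / r) = t) by (intros; field; lra).
    assert (Hdiv : forall t, 0 < t -> 0 < t / r) by (intros; apply Rdiv_lt_0_compat; auto).
    assert (Hs : is_RInt_gen (fun t => dg t * (g t ^ j * exp (- (r * g t ^ S d)))) (at_right 0) (Rbar_locally p_infty) l).
    { apply (is_RInt_gen_subst (fun x => x ^ j * exp (- (r * x ^ S d)))); auto.
      - intros x Hx. split; [apply Rpower_pos|].
        assert (Hd1 : forall q, is_derive (fun t => Rpower (t / r) q) x (q * Rpower (x / r) (q - 1) * / r)).
        { intros q. replace (q * Rpower (x / r) (q - 1) * / r) with (scal (/ r) (q * Rpower (x / r) (q - 1)))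
            by (unfold scal; simpl; unfold mult; simpl; ring).
          apply (is_derive_comp (fun y => Rpower y q) (fun t => t / r)).
          - apply is_derive_Rpower; auto.
          - auto_derive; auto. ring. }
        split; [apply Hd1|]. unfold dg.
        apply (cont_mult (fun t => / INR (S d) * Rpower (t / r) (/ INR (S d) - 1)) (fun _ => / r)); [|apply continuous_const].
        apply (continuous_scal_r (/ INR (S d)) (fun t => Rpower (t / r) (/ INR (S d) - 1))).
        apply (is_derive_cont _ _ _ (Hd1 _)).
      - intros x _. apply continuous_monomial_exp.
      - intros P [e He].
        assert (Hre : 0 < r * e ^ S d) by (apply Rmult_lt_0_compat; [auto|apply pow_lt, cond_pos]).
        exists (mkposreal _ Hre). intros t Ht Ht0. change (Rabs (t - 0) < r * e ^ S d) in Ht.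
        rewrite Rminus_0_r, Rabs_pos_eq in Ht by lra.
        apply He; [|apply Rpower_pos]. change (Rabs (g t - 0) < e).
        rewrite Rminus_0_r, Rabs_pos_eq by (left; apply Rpower_pos).
        destruct (Rlt_dec (g t) e) as [h|h]; auto. exfalso.
        assert (e ^ S d <= g t ^ S d) by (apply pow_incr; pose proof (cond_pos e); lra).
        unfold g in H. rewrite Rpower_inv_pow in H by auto.
        apply (Rmult_le_compat_l r) in H; [|lra]. rewrite Hcan in H. lra.
      - intros P [M HM]. exists (r * (Rabs M + 1) ^ S d). intros t Ht. apply HM.
        assert (HM1 : 0 < (Rabs M + 1) ^ S d) by (apply pow_lt; pose proof (Rabs_pos M); lra).
        assert (Ht0 : 0 < t) by nra.
        destruct (Rlt_dec M (g t)) as [h|h]; auto. exfalso.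
        assert (g t ^ S d <= (Rabs M + 1) ^ S d).
        { apply pow_incr. split; [left; apply Rpower_pos|]. pose proof (Rle_abs M); lra. }
        unfold g in H. rewrite Rpower_inv_pow in H by auto.
        apply (Rmult_le_compat_l r) in H; [|lra]. rewrite Hcan in H. lra. }
    apply (is_RInt_gen_ext (V := R_NormedModule) (fun t => scal (INR (S d) * Rpower r al) (dg t * (g t ^ j * exp (- (r * g t ^ S d)))))).
    - eapply filter_imp; [|exact segment_pos]. intros [a b] [_ Hab] t Ht. simpl in Hab, Ht.
      assert (Ht0 : 0 < t) by (apply Hab; lra).
      assert (Hgp : r * g t ^ S d = t) by (unfold g; rewrite Rpower_inv_pow by auto; apply Hcan).
      rewrite Hgp. change (INR (S d) * Rpower r al * (dg t * (g t ^ j * exp (- t))) = Rpower t (al - 1) * exp (- t)).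
      unfold g, dg. rewrite <- Rpower_pow, Rpower_mult by apply Rpower_pos.
      transitivity (Rpower r al * / r * (Rpower (t / r) (/ INR (S d) - 1) * Rpower (t / r) (/ INR (S d) * INR j)) * exp (- t)).
      { field. split; lra. }
      rewrite <- Rpower_plus.
      replace (/ INR (S d) - 1 + / INR (S d) * INR j) with (al - 1) by (unfold al; rewrite (S_INR j); field; lra).
      f_equal. unfold Rdiv. rewrite <- Rpower_mult_distr by (auto; apply Rinv_0_lt_compat; auto).
      replace (Rpower r al) with (Rpower r (al - 1) * r).
      2:{ rewrite <- (Rpower_1 r Hr) at 2. rewrite <- Rpower_plus. f_equal; ring. }
      transitivity (Rpower t (al - 1) * (Rpower r (al - 1) * Rpower (/ r) (al - 1))); [field; lra|].
      rewrite Rpower_mult_distr, Rinv_r by (try apply Rinv_0_lt_compat; lra).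
      unfold Rpower at 2. rewrite ln_1, Rmult_0_r, exp_0. ring.
    - apply (is_RInt_gen_scal (V := R_NormedModule)); auto. }
  assert (H : Gamma al = INR (S d) * Rpower r al * l).
  { clearbody al. unfold Gamma. apply (is_RInt_gen_unique (V := R_CompleteNormedModule) (fun t => Rpower t (al - 1) * exp (- t))). exact HG. }
  replace (Gamma al / INR (S d) * Rpower r (- al)) with l; auto.
  rewrite H, Rpower_Ropp. field. split; [|lra]. apply Rgt_not_eq, Rpower_pos.
Qed.

Ltac cont2d :=
  repeat first
    [ apply continuity_2d_pt_const | apply continuity_2d_pt_id1 | apply continuity_2d_pt_id2
    | apply continuity_2d_pt_mult | apply continuity_2d_pt_plus | apply continuity_2d_pt_minus
    | apply continuity_2d_pt_opp
    | apply (continuity_1d_2d_pt_comp cos); [apply continuity_cos|]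
    | apply (continuity_1d_2d_pt_comp sin); [apply continuity_sin|]
    | apply (continuity_1d_2d_pt_comp exp); [apply derivable_continuous_pt, derivable_pt_exp|]
    | apply (continuity_1d_2d_pt_comp (fun x => pow x _)); [apply derivable_continuous_pt, derivable_pt_pow|] ].

Section Rotation.

Variables (j d : nat) (r th : R).
Hypothesis Hr : 0 < r.

Let al := INR (S j) / INR (S d).

Definition rot_phase (be x : R) : R := r * sin be * x ^ S d + th - al * be.

(** On the ray z = x e^(-i be/m), with m = d + 1, this is the real part of e^(i th) z^j exp(-r z^m)
    dz/dx: here z^m = x^m e^(-i be), and z^j dz/dx contributes the phase -(j+1) be/m = -al be. *)
Definition rot (be x : R) : R :=
  x ^ j * (exp (- (r * cos be * x ^ S d)) * cos (rot_phase be x)).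

Definition rot_be (be x : R) : R :=
  x ^ j * (exp (- (r * cos be * x ^ S d)) *
    (r * sin be * x ^ S d * cos (rot_phase be x)
     - (r * cos be * x ^ S d - al) * sin (rot_phase be x))).

(** The real part of e^(i th) z^j exp(-r z^m) dz/dbe on the same ray. Since dz/dbe = -i z/m, there
    appear a factor 1/m, one more power of x, and a sine in place of the cosine. *)
Definition rot_flux (be x : R) : R :=
  / INR (S d) * (x ^ S j * (exp (- (r * cos be * x ^ S d)) * sin (rot_phase be x))).

Lemma is_derive_rot_be be x : is_derive (fun b => rot b x) be (rot_be be x).
Proof. unfold rot, rot_be, rot_phase. auto_derive; trivial. unfold Rminus. simpl pow. ring. Qed.

(* This is Cauchy's theorem for the rotation of the ray of integration: the
   derivative of [rot] in the angle [be] is also a derivative in [x]. *)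
Lemma is_derive_rot_flux be x : is_derive (fun x => rot_flux be x) x (rot_be be x).
Proof.
  assert (Hm : INR (S d) <> 0) by (apply not_0_INR; lia).
  unfold rot_be, rot_flux, rot_phase. auto_derive; trivial.
  change (pred (S j)) with j. change (pred (S d)) with d.
  change (match d with O => 1 | S _ => INR d + 1 end) with (INR (S d)).
  change (match j with O => 1 | S _ => INR j + 1 end) with (INR (S j)).
  change (x * x ^ d) with (x ^ S d). change (x * x ^ j) with (x ^ S j).
  change (r * sin be * x ^ S d + th + - (al * be)) with (r * sin be * x ^ S d + th - al * be).
  generalize (sin (r * sin be * x ^ S d + th - al * be)) (cos (r * sin be * x ^ S d + th - al * be))
    (exp (- (r * cos be * x ^ S d))) (cos be) (sin be). intros s c e cb sb.
  replace (INR (S j)) with (al * INR (S d)) by (unfold al; field; auto).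
  simpl pow. clearbody al. field. exact Hm.
Qed.

Lemma rot_be_continuous_2d be x : continuity_2d_pt rot_be be x.
Proof. unfold rot_be, rot_phase. cont2d. Qed.

Lemma continuous_rot be x : continuous (fun x => rot be x) x.
Proof. unfold rot, rot_phase. apply (ex_derive_continuous (fun x => x ^ j *
  (exp (- (r * cos be * x ^ S d)) * cos (r * sin be * x ^ S d + th - al * be)))). auto_derive. trivial. Qed.

(** After differentiation under the integral sign the integrand is an exact derivative in x, so only
    the fluxes through the two arcs at the ends remain. *)
Lemma is_derive_RInt_rot be a b :
  is_derive (fun be => RInt (fun x => rot be x) a b) be (rot_flux be b - rot_flux be a).
Proof.
  assert (HD : forall u v, Derive (fun z => rot z v) u = rot_be u v)
    by (intros; apply is_derive_unique, is_derive_rot_be).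
  replace (rot_flux be b - rot_flux be a) with (RInt (fun t => Derive (fun u => rot u t) be) a b).
  - apply (is_derive_RInt_param rot).
    + apply filter_forall. intros y t _. eexists; apply is_derive_rot_be.
    + intros t _. apply (continuity_2d_pt_ext rot_be); [intros; symmetry; apply HD|].
      apply rot_be_continuous_2d.
    + apply filter_forall. intros y. apply cont_ex_RInt. intros x _. apply continuous_rot.
  - apply (is_RInt_unique (V := R_CompleteNormedModule)).
    apply (is_RInt_ext (V := R_NormedModule) (fun t => rot_be be t)); [intros; symmetry; apply HD|].
    apply (is_RInt_derive (V := R_CompleteNormedModule) (fun x => rot_flux be x)).
    + intros; apply is_derive_rot_flux.
    + intros x _. unfold rot_be, rot_phase. apply (ex_derive_continuous (fun x => x ^ j * (exp (- (r * cos be * x ^ S d)) *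
    (r * sin be * x ^ S d * cos (r * sin be * x ^ S d + th - al * be)
     - (r * cos be * x ^ S d - al) * sin (r * sin be * x ^ S d + th - al * be))))). auto_derive. trivial.
Qed.

(** The cosine decreases on [0, pi/2], so the slowest exponential decay is that of the largest
    angle; this gives a bound uniform over the unknown angle which the mean value theorem
    returns. *)
Lemma rot_flux_bound be0 be x : 0 <= be <= be0 -> be0 < PI / 2 -> 0 <= x ->
  Rabs (rot_flux be x) <= x ^ S j * exp (- (r * cos be0 * x ^ S d)).
Proof.
  intros Hbe Hbe0 Hx. unfold rot_flux.
  assert (Hm : 1 <= INR (S d)) by (rewrite S_INR; pose proof (pos_INR d); lra).
  assert (Hc : cos be0 <= cos be) by (apply cos_decr_1; lra).
  rewrite !Rabs_mult, (Rabs_pos_eq (/ _)), (Rabs_pos_eq (x ^ _)), (Rabs_pos_eq (exp _));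
    try (left; apply exp_pos); try (apply pow_le; auto); try (left; apply Rinv_0_lt_compat; lra).
  assert (Hi : / INR (S d) <= 1) by (rewrite <- Rinv_1; apply Rinv_le_contravar; lra).
  assert (Hi0 : 0 < / INR (S d)) by (apply Rinv_0_lt_compat; lra).
  assert (Hs : Rabs (sin (rot_phase be x)) <= 1) by (apply Rabs_le, SIN_bound).
  pose proof (Rabs_pos (sin (rot_phase be x))).
  pose proof (pow_le x (S j) Hx). pose proof (pow_le x (S d) Hx).
  assert (He : exp (- (r * cos be * x ^ S d)) <= exp (- (r * cos be0 * x ^ S d))).
  { assert (h : - (r * cos be * x ^ S d) <= - (r * cos be0 * x ^ S d)).
    { apply Ropp_le_contravar. apply Rmult_le_compat_r; auto. apply Rmult_le_compat_l; lra. }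
    destruct h as [h|h]; [left; apply exp_increasing; auto|rewrite h; lra]. }
  pose proof (exp_pos (- (r * cos be * x ^ S d))).
  apply Rle_trans with (1 * (x ^ S j * (exp (- (r * cos be0 * x ^ S d)) * 1))); [|lra].
  apply Rmult_le_compat; try lra.
  - apply Rmult_le_pos; auto. apply Rmult_le_pos; lra.
  - apply Rmult_le_compat_l; auto. apply Rmult_le_compat; lra.
Qed.

(** On a segment [a, b] the mean value theorem in the angle compares [be] with 0, where the integral
    is the Gamma integral. The difference is at most pi times the fluxes at the ends, of size a and
    M/b; the latter uses cos be > 0. *)
Lemma rot_integral (be : R) : 0 <= be < PI / 2 ->
  is_RInt_gen (fun x => rot be x) (at_right 0) (Rbar_locally p_infty)
    (cos th * (Gamma al / INR (S d) * Rpower r (- al))).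
Proof.
  intros Hbe.
  set (l := Gamma al / INR (S d) * Rpower r (- al)).
  assert (H0 : is_RInt_gen (fun x => rot 0 x) (at_right 0) (Rbar_locally p_infty) (cos th * l)).
  { apply (is_RInt_gen_ext (V := R_NormedModule) (fun x => scal (cos th) (x ^ j * exp (- (r * x ^ S d))))).
    - apply filter_forall. intros ab x _. unfold rot, rot_phase. rewrite sin_0, cos_0, Rmult_0_r, Rmult_0_r, Rmult_0_l, Rmult_1_r.
      rewrite Rplus_0_l, Rminus_0_r. unfold scal; simpl. unfold mult; simpl. ring.
    - apply (is_RInt_gen_scal (V := R_NormedModule)). apply monomial_exp_integral; auto. }
  apply is_RInt_gen_lim in H0; try typeclasses eauto.
  apply (filterlimi_lim_ext_loc (fun ab : R * R => RInt (fun x => rot be x) (fst ab) (snd ab))).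
  { apply filter_forall. intros ab. apply (RInt_correct (V := R_CompleteNormedModule)), cont_ex_RInt.
    intros; apply continuous_rot. }
  apply filterlim_Rabs_lt; [typeclasses eauto|]. intros e He.
  assert (Hrc : 0 < r * cos be) by (apply Rmult_lt_0_compat; auto; apply cos_gt_0; lra).
  destruct (pow_mul_exp_neg_bounded d (S (S j)) _ Hrc) as [M [HM HM']].
  pose proof PI_RGT_0.
  assert (HA : filter_prod (at_right 0) (Rbar_locally p_infty) (fun ab : R * R =>
     0 < fst ab <= 1 /\ 1 <= snd ab /\ PI * (fst ab + M / snd ab) < e / 2)).
  (* The thresholds make each of pi a and pi M/b smaller than e/4. *)
  { assert (Hd : 0 < Rmin 1 (e / (4 * PI))) by (apply Rmin_pos; [lra|apply Rdiv_lt_0_compat; lra]).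
    apply (Filter_prod _ _ _ (fun a => 0 < a < Rmin 1 (e / (4 * PI))) (fun b => Rmax 1 (4 * PI * M / e) < b)).
    - exists (mkposreal _ Hd). intros y Hy Hy0. change (Rabs (y - 0) < Rmin 1 (e / (4 * PI))) in Hy.
      rewrite Rminus_0_r, Rabs_pos_eq in Hy; lra.
    - exists (Rmax 1 (4 * PI * M / e)). auto.
    - intros a b [Ha0 Ha] Hb. simpl.
      pose proof (Rmin_l 1 (e / (4 * PI))). pose proof (Rmin_r 1 (e / (4 * PI))).
      pose proof (Rmax_l 1 (4 * PI * M / e)). pose proof (Rmax_r 1 (4 * PI * M / e)).
      split; [lra|]. split; [lra|].
      assert (H5 : a < e / (4 * PI)) by lra. assert (H6 : 4 * PI * M / e < b) by lra.
      apply (Rmult_lt_compat_l (4 * PI)) in H5; [|lra].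
      replace (4 * PI * (e / (4 * PI))) with e in H5 by (field; lra).
      apply (Rmult_lt_compat_r e) in H6; [|lra].
      replace (4 * PI * M / e * e) with (4 * PI * M) in H6 by (field; lra).
      apply (Rmult_lt_reg_r (4 * b)); [lra|].
      replace (PI * (a + M / b) * (4 * b)) with (4 * PI * a * b + 4 * PI * M) by (field; lra).
      nra. }
  assert (He2 : 0 < e / 2) by lra.
  pose proof (proj1 (filterlim_Rabs_lt _ _ _) H0 _ He2) as H1.
  eapply filter_imp; [|exact (filter_and _ _ HA H1)].
  intros [a b] [[Ha1 [Hb1 Hsm]] Hl]. simpl in Ha1, Hb1, Hsm, Hl. simpl fst; simpl snd.
  set (H_ := fun be => RInt (fun x => rot be x) a b).
  assert (Hdiff : Rabs (H_ be - H_ 0) <= PI * (a + M / b)).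
  { destruct (MVT_gen H_ 0 be (fun be => rot_flux be b - rot_flux be a)) as [c [Hc E]].
    - intros; apply is_derive_RInt_rot.
    - intros x _. apply continuity_pt_filterlim. apply (is_derive_cont _ _ _ (is_derive_RInt_rot x a b)).
    - rewrite Rmin_left, Rmax_right in Hc by lra. rewrite E, Rminus_0_r, Rabs_mult, (Rabs_pos_eq be) by lra.
      assert (Hx : forall x, 0 <= x -> x ^ S (S j) * exp (- (r * cos be * x ^ S d)) <= M) by exact HM'.
      assert (Fb : Rabs (rot_flux c b) <= M / b).
      { apply Rle_trans with (1 := rot_flux_bound be c b Hc (proj2 Hbe) ltac:(lra)).
        apply (Rmult_le_reg_r b); [lra|]. replace (M / b * b) with M by (field; lra).
        specialize (Hx b ltac:(lra)). simpl pow in Hx |- *. lra. }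
      assert (Fa : Rabs (rot_flux c a) <= a).
      { apply Rle_trans with (1 := rot_flux_bound be c a Hc (proj2 Hbe) ltac:(lra)).
        assert (Hp : a ^ j <= 1) by (rewrite <- (pow1 j); apply pow_incr; lra).
        pose proof (pow_le a j ltac:(lra)).
        assert (Hx1 : exp (- (r * cos be * a ^ S d)) <= 1).
        { rewrite <- exp_0. left; apply exp_increasing. pose proof (pow_lt a (S d) ltac:(lra)). nra. }
        pose proof (exp_pos (- (r * cos be * a ^ S d))).
        change (a ^ S j) with (a * a ^ j). rewrite Rmult_assoc. apply Rle_trans with (a * 1); [|lra].
        apply Rmult_le_compat_l; nra. }
      pose proof (Rabs_triang (rot_flux c b) (- rot_flux c a)) as Ht. rewrite Rabs_Ropp in Ht.
      pose proof (Rabs_pos (rot_flux c b + - rot_flux c a)). unfold Rminus.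
      rewrite Rmult_comm. apply Rmult_le_compat; lra. }
  unfold H_ in Hdiff.
  replace (RInt (fun x => rot be x) a b - cos th * l) with
    ((RInt (fun x => rot be x) a b - RInt (fun x => rot 0 x) a b) + (RInt (fun x => rot 0 x) a b - cos th * l)) by ring.
  eapply Rle_lt_trans; [apply Rabs_triang|]. lra.
Qed.

End Rotation.

(** * Monomials and Taylor remainders *)

Lemma osc_limit_ext m Fa Fb {FFa : Filter Fa} {FFb : Filter Fb} lam th f g psi E :
  (forall x, f x = g x) -> osc_limit m Fa Fb lam th f psi E -> osc_limit m Fa Fb lam th g psi E.
Proof.
  intros H [J [HJ L]]. exists J. split; auto. intros eps He.
  apply (is_RInt_gen_ext (V := R_NormedModule) (fun x => cos (lam * x ^ m + th) * (f x * psi (eps * x)))); auto.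
  apply filter_forall. intros ab x _. rewrite H. reflexivity.
Qed.

(** All powers [j] are treated at once because the derivative is a combination of two functions of
    the same form, with other powers. *)
Lemma rapid_monomial_exp (d n : nat) : forall j, rapid n (fun t => t ^ j * exp (- (1 * t ^ S d))).
Proof.
  induction n; intros j; split; auto.
  1,2: intros i; destruct (pow_mul_exp_neg_bounded d (i + j) 1 Rlt_0_1) as [M [_ HM]]; exists M;
    intros t Ht; rewrite Rabs_pos_eq by (apply Rmult_le_pos; [apply pow_le; auto|left; apply exp_pos]);
    rewrite <- Rmult_assoc, <- pow_add; auto.
  exists (fun t => INR j * (t ^ pred j * exp (- (1 * t ^ S d))) + - INR (S d) * (t ^ (j + d) * exp (- (1 * t ^ S d)))).
  split.
  - intros t. auto_derive; trivial. change (pred (S d)) with d.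
    change (match d with O => 1 | S _ => INR d + 1 end) with (INR (S d)).
    rewrite pow_add. change (t * t ^ d) with (t ^ S d). ring.
  - apply rapid_plus; apply rapid_scal; apply IHn.
Qed.

(** This cutoff merges with the oscillation into exp(-(eps^m - i lam) x^m), and [r], [be] are polar
    coordinates of its coefficient: r cos be = eps^m and r sin be = lam. The rotated integral
    therefore gives an exact value for each eps > 0, with [th] shifted by al be to compensate the
    phase of the ray; as eps tends to 0, r tends to lam and be to pi/2. *)
Lemma osc_limit_monomial_exp (d j : nat) (lam th : R) : 0 < lam ->
  let al := INR (S j) / INR (S d) in
  osc_limit (S d) (at_right 0) (Rbar_locally p_infty) lam th (fun x => x ^ j) (fun t => exp (- (1 * t ^ S d)))
    (cos (th + al * (PI / 2)) * (Gamma al / INR (S d) * Rpower lam (- al))).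
Proof.
  intros Hlam al.
  set (r := fun eps => lam * sqrt (1 + (eps ^ S d / lam) ^ 2)).
  set (be := fun eps => PI / 2 - atan (eps ^ S d / lam)).
  assert (Hs : forall y, 0 < sqrt (1 + y ^ 2)) by (intros; apply sqrt_lt_R0; nra).
  exists (fun eps => cos (th + al * be eps) * (Gamma al / INR (S d) * Rpower (r eps) (- al))).
  split.
  - intros eps He.
    assert (Hy : 0 < eps ^ S d / lam) by (apply Rdiv_lt_0_compat; auto; apply pow_lt; auto).
    assert (Hr : 0 < r eps) by (apply Rmult_lt_0_compat; auto).
    assert (Hc : r eps * cos (be eps) = eps ^ S d).
    { unfold be, r. rewrite cos_shift, sin_atan. specialize (Hs (eps ^ S d / lam)).
      unfold Rsqr. replace (eps ^ S d / lam * (eps ^ S d / lam)) with ((eps ^ S d / lam) ^ 2) by ring.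
      field. split; lra. }
    assert (Hsn : r eps * sin (be eps) = lam).
    { unfold be, r. rewrite sin_shift, cos_atan. specialize (Hs (eps ^ S d / lam)).
      unfold Rsqr. replace (eps ^ S d / lam * (eps ^ S d / lam)) with ((eps ^ S d / lam) ^ 2) by ring.
      field. lra. }
    apply (is_RInt_gen_ext (V := R_NormedModule) (fun x => rot j d (r eps) (th + al * be eps) (be eps) x)).
    + apply filter_forall. intros ab x _. unfold rot, rot_phase. rewrite Hc, Hsn. fold al.
      replace (lam * x ^ S d + (th + al * be eps) - al * be eps) with (lam * x ^ S d + th) by ring.
      replace (1 * (eps * x) ^ S d) with (eps ^ S d * x ^ S d) by (rewrite Rpow_mult_distr; ring).
      match goal with |- ?u = ?v => change (@eq R u v) end. ring.
    + apply rot_integral; auto. unfold be.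
      assert (0 < atan (eps ^ S d / lam)) by (rewrite <- atan_0; apply atan_increasing; auto).
      pose proof (atan_bound (eps ^ S d / lam)). lra.
  - apply filterlim_at_right_cont.
    + clear Hs. unfold r, be. unfold Rpower.
      apply (ex_derive_continuous (fun eps => cos (th + al * (PI / 2 - atan (eps ^ S d / lam))) *
        (Gamma al / INR (S d) * exp (- al * ln (lam * sqrt (1 + (eps ^ S d / lam) ^ 2)))))).
      assert (H0 : 0 < 1 + (0 ^ S d / lam) ^ 2) by nra.
      auto_derive. simpl pow in *. repeat split; auto; try lra.
      apply Rmult_lt_0_compat; auto. apply sqrt_lt_R0; auto.
    + unfold r, be. rewrite pow_i by lia. replace (0 / lam) with 0 by (field; lra). rewrite atan_0, Rminus_0_r.
      replace (1 + 0 ^ 2) with 1 by ring. rewrite sqrt_1, Rmult_1_r. reflexivity.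
Qed.

Lemma symbol_pow delta n : -1 <= delta -> forall j, symbol delta n 0 (INR j) (fun x => x ^ j).
Proof.
  intros Hd. induction n; intros j; split.
  1,3: exists 1; intros x Hx; rewrite Rmult_1_l, Rabs_pos_eq by (apply pow_le; lra);
    unfold weight; destruct (Rle_dec x 1); [rewrite Rpower_O by auto; rewrite <- (pow1 j); apply pow_incr; lra
                                           |rewrite Rpower_pow by auto; lra].
  - intros x _. apply (ex_derive_continuous (fun x => x ^ j)). auto_derive; trivial.
  - exists (fun x => INR j * x ^ pred j). split.
    + intros x _. auto_derive; trivial. ring.
    + destruct j as [|j].
      * assert (E : (fun x : R => INR 0 * x ^ pred 0) = (fun _ => 0)).
        { apply functional_extensionality. intros x. simpl. ring. }
        rewrite E. apply symbol_zero.
      * apply symbol_scal. apply (symbol_mono _ _ 0 _ (INR j)); [lra| |apply IHn].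
        rewrite S_INR. lra.
Qed.

Lemma order_ex (kappa tau : R) : 0 < kappa -> exists N : nat, tau <= -3 + INR N * kappa.
Proof.
  intros Hk. destruct (nfloor_ex (Rabs ((tau + 3) / kappa)) (Rabs_pos _)) as [N [_ HN]].
  exists (S N). rewrite S_INR. pose proof (Rle_abs ((tau + 3) / kappa)).
  assert (H1 : (tau + 3) / kappa <= INR N + 1) by lra.
  apply (Rmult_le_compat_r kappa) in H1; [|lra].
  replace ((tau + 3) / kappa * kappa) with (tau + 3) in H1 by (field; lra). lra.
Qed.

Lemma osc_limit_monomial (d j : nat) (lam th : R) (psi : R -> R) : 0 < lam ->
  (forall n, rapid n psi) ->
  let al := INR (S j) / INR (S d) in
  osc_limit (S d) (at_right 0) (Rbar_locally p_infty) lam th (fun x => x ^ j) psi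
    (psi 0 * (cos (th + al * (PI / 2)) * (Gamma al / INR (S d) * Rpower lam (- al)))).
Proof.
  intros Hlam Hpsi al.
  (* A monomial loses a full power with each derivative, so delta = -1 is available, and it lies
     below d even when m = 1. *)
  assert (Hd : -1 <= -1 < INR d) by (pose proof (pos_INR d); lra).
  destruct (order_ex (INR d - -1) (INR j)) as [N HN]; [lra|].
  destruct (osc_limit_half_line d (-1) 0 Hd N (INR j) (fun x => x ^ j)) as [C [_ H]].
  - simpl INR. rewrite Rmult_0_l. apply symbol_pow. lra.
  - exact HN.
  - destruct (H lam th Hlam) as [E [_ HE]].
    assert (EE : exp (- (1 * 0 ^ S d)) * E = cos (th + al * (PI / 2)) * (Gamma al / INR (S d) * Rpower lam (- al))).
    { apply (osc_limit_unique (S d) (at_right 0) (Rbar_locally p_infty) lam th (fun x => x ^ j) (fun t => exp (- (1 * t ^ S d)))).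
      - apply (HE (fun t => exp (- (1 * t ^ S d)))).
        assert (Ee : (fun t => exp (- (1 * t ^ S d))) = (fun t => t ^ 0 * exp (- (1 * t ^ S d)))).
        { apply functional_extensionality. intros t. simpl. ring. }
        rewrite Ee. apply rapid_monomial_exp.
      - apply osc_limit_monomial_exp; auto. }
    rewrite <- EE. rewrite pow_i by lia. rewrite Rmult_0_r, Ropp_0, exp_0, Rmult_1_l. apply HE. auto.
Qed.

(** It has [n] terms where [sum_n c n] has n + 1, so that the empty Taylor polynomial is
    included. *)
Fixpoint psum (c : nat -> R) (n : nat) : R :=
  match n with O => 0 | S n' => psum c n' + c n' end.

Lemma psum_sum_n c n : psum c (S n) = sum_n c n.
Proof.
  induction n.
  - rewrite sum_O. simpl. ring.
  - rewrite sum_Sn, <- IHn. reflexivity.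
Qed.

(** [F] stands for a sequence of successive derivatives, and [M] is the number of terms, not the
    degree. The index [k] makes the family closed under differentiation: [k] goes up by one as [M]
    goes down by one. *)
Definition taylor (F : nat -> R -> R) (k M : nat) (x : R) : R :=
  psum (fun i => F (k + i)%nat 0 / INR (fact i) * x ^ i) M.

Lemma is_derive_taylor F k M x : is_derive (taylor F k (S M)) x (taylor F (S k) M x).
Proof.
  induction M.
  - unfold taylor; simpl. apply (is_derive_ext (fun _ => 0 + F (k + 0)%nat 0 / 1 * 1)); [reflexivity|].
    auto_derive; trivial.
  - apply (is_derive_ext (fun x => taylor F k (S M) x + F (k + S M)%nat 0 / INR (fact (S M)) * x ^ S M)); [reflexivity|].
    change (taylor F (S k) (S M) x) with (taylor F (S k) M x + F (S k + M)%nat 0 / INR (fact M) * x ^ M).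
    apply (is_derive_plus (taylor F k (S M)) (fun x => F (k + S M)%nat 0 / INR (fact (S M)) * x ^ S M)); auto.
    replace (S k + M)%nat with (k + S M)%nat by lia.
    generalize (F (k + S M)%nat 0). intros c.
    replace (c / INR (fact M) * x ^ M) with (c / INR (fact (S M)) * (INR (S M) * 1 * x ^ pred (S M))).
    + apply (is_derive_scal (fun x => x ^ S M) x (c / INR (fact (S M)))).
      apply (is_derive_pow (fun x => x)). apply (is_derive_id (K := R_AbsRing)).
    + simpl pred. change (fact (S M)) with (S M * fact M)%nat. rewrite mult_INR. field.
      split; [apply INR_fact_neq_0|apply not_0_INR; lia].
Qed.

Lemma taylor_at_0 F k M : taylor F k (S M) 0 = F k 0.
Proof.
  induction M.
  - unfold taylor; simpl. rewrite Nat.add_0_r. field.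
  - change (taylor F k (S (S M)) 0) with (taylor F k (S M) 0 + F (k + S M)%nat 0 / INR (fact (S M)) * 0 ^ S M).
    rewrite IHM, pow_i by lia. ring.
Qed.

Lemma taylor_growth F k M : exists C, 0 <= C /\ forall x, 1 <= x -> Rabs (taylor F k M x) <= C * x ^ M.
Proof.
  induction M.
  - exists 0. split; [lra|]. intros x Hx. unfold taylor; simpl. rewrite Rabs_R0. lra.
  - destruct IHM as [C [HC H]]. set (c := F (k + M)%nat 0 / INR (fact M)).
    exists (C + Rabs c). split; [pose proof (Rabs_pos c); lra|]. intros x Hx.
    change (taylor F k (S M) x) with (taylor F k M x + c * x ^ M).
    assert (Hp : x ^ M <= x ^ S M) by (apply Rle_pow; auto).
    assert (Hp0 : 0 <= x ^ M) by (apply pow_le; lra).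
    eapply Rle_trans; [apply Rabs_triang|]. rewrite Rabs_mult, (Rabs_pos_eq (x ^ M)) by auto.
    specialize (H x Hx). pose proof (Rabs_pos c). nra.
Qed.

Lemma continuous_bounded_01 (f : R -> R) : (forall x, continuous f x) ->
  exists C, 0 <= C /\ forall x, 0 <= x <= 1 -> Rabs (f x) <= C.
Proof.
  intros H. destruct (bounded_continuity (V := R_NormedModule) f 0 1 (fun x _ => H x)) as [M HM].
  exists (Rabs M). split; [apply Rabs_pos|]. intros x Hx. pose proof (HM x Hx) as h.
  change (Rabs (f x) < M) in h. pose proof (Rle_abs M). lra.
Qed.

(** The remainder vanishes at 0, and its derivative is the remainder of the next derivative with one
    term fewer; the mean value theorem then gains a factor x per induction step without changing the
    constant. *)
Lemma taylor_remainder_near_0 (F : nat -> R -> R) (J : nat) :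
  (forall k x, is_derive (F k) x (F (S k) x)) ->
  forall i k, (k + i = J)%nat ->
  exists C, 0 <= C /\ forall x, 0 <= x <= 1 -> Rabs (F k x - taylor F k i x) <= C * x ^ i.
Proof.
  intros HF. induction i; intros k Hk.
  - destruct (continuous_bounded_01 (F k)) as [C [HC H]].
    { intros x. apply (is_derive_cont _ _ _ (HF k x)). }
    exists C. split; auto. intros x Hx. unfold taylor; simpl. rewrite Rminus_0_r, Rmult_1_r. auto.
  - destruct (IHi (S k) ltac:(lia)) as [C [HC H]].
    exists C. split; auto. intros x Hx.
    assert (HD : forall y, is_derive (fun y => F k y - taylor F k (S i) y) y (F (S k) y - taylor F (S k) i y)).
    { intros y. apply (is_derive_minus (F k) (taylor F k (S i))); auto. apply is_derive_taylor. }
    destruct (MVT_gen (fun y => F k y - taylor F k (S i) y) 0 x (fun y => F (S k) y - taylor F (S k) i y)) as [c [Hc E]].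
    + intros; apply HD.
    + intros y _. apply continuity_pt_filterlim. apply (is_derive_cont _ _ _ (HD y)).
    + rewrite Rmin_left, Rmax_right in Hc by lra.
      rewrite taylor_at_0, Rminus_diag, !Rminus_0_r in E. rewrite E, Rabs_mult, (Rabs_pos_eq x) by lra.
      specialize (H c ltac:(lra)). assert (c ^ i <= x ^ i) by (apply pow_incr; lra).
      apply Rle_trans with (C * x ^ i * x); [|simpl; lra].
      apply Rmult_le_compat_r; [lra|]. apply Rle_trans with (1 := H). apply Rmult_le_compat_l; auto.
Qed.

(** Subtracting the polynomial buys order J at 0 at the price of growth of order J at infinity,
    hence [Rmax]. The truncated [J - k] is intended: once k >= J nothing is left to subtract, and
    boundedness near 0 is enough because the exponent J - k is not positive. At infinity, x^(J-k) is
    at most x^(J + delta k) because delta >= -1. *)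
Lemma taylor_remainder_symbol (F : nat -> R -> R) (delta tau : R) (n J : nat) :
  -1 <= delta ->
  (forall k x, is_derive (F k) x (F (S k) x)) ->
  (forall k, exists C, forall x, 1 <= x -> Rabs (F k x) <= C * Rpower x (tau + delta * INR k)) ->
  symbol delta n (INR J) (Rmax tau (INR J)) (fun x => F O x - taylor F O J x).
Proof.
  intros Hd HF HB.
  replace (fun x => F O x - taylor F O J x) with ((fun k x => F k x - taylor F k (J - k) x) O)
    by (cbv beta; rewrite Nat.sub_0_r; reflexivity).
  apply (symbol_of_derivatives delta n (fun k x => F k x - taylor F k (J - k) x)).
  - intros k x _. apply (is_derive_minus (F k) (taylor F k (J - k))); auto.
    destruct (Nat.le_gt_cases J k).
    + replace (J - k)%nat with O by lia. replace (J - S k)%nat with O by lia.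
      apply (is_derive_const (K := R_AbsRing) 0).
    + replace (J - k)%nat with (S (J - S k)) by lia. apply is_derive_taylor.
  - intros k.
    assert (H0 : exists C, 0 <= C /\ forall x, 0 < x <= 1 -> Rabs (F k x - taylor F k (J - k) x) <= C * Rpower x (INR J - INR k)).
    { destruct (Nat.le_gt_cases J k) as [h|h].
      - replace (J - k)%nat with O by lia. destruct (continuous_bounded_01 (F k)) as [C [HC H]].
        { intros x. apply (is_derive_cont _ _ _ (HF k x)). }
        exists C. split; auto. intros x Hx. unfold taylor; simpl. rewrite Rminus_0_r.
        apply Rle_trans with (C * 1); [rewrite Rmult_1_r; apply H; lra|]. apply Rmult_le_compat_l; auto.
        rewrite <- (Rpower_O x) by lra. apply Rpower_le_exp_small; auto. apply le_INR in h. lra.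
      - destruct (taylor_remainder_near_0 F J HF (J - k) k ltac:(lia)) as [C [HC H]].
        exists C. split; auto. intros x Hx. rewrite <- minus_INR, Rpower_pow by (lia || lra). apply H; lra. }
    assert (H1 : exists C, 0 <= C /\ forall x, 1 <= x ->
      Rabs (F k x - taylor F k (J - k) x) <= C * Rpower x (Rmax tau (INR J) + delta * INR k)).
    { destruct (HB k) as [C1 H1]. destruct (taylor_growth F k (J - k)) as [C2 [HC2 H2]].
      exists (Rabs C1 + C2). split; [pose proof (Rabs_pos C1); lra|]. intros x Hx.
      unfold Rminus. eapply Rle_trans; [apply Rabs_triang|]. rewrite Rabs_Ropp, Rmult_plus_distr_r.
      apply Rplus_le_compat.
      - apply Rle_trans with (1 := H1 x Hx).
        apply Rle_trans with (Rabs C1 * Rpower x (tau + delta * INR k)).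
        + apply Rmult_le_compat_r; [left; apply Rpower_pos|apply Rle_abs].
        + apply Rmult_le_compat_l; [apply Rabs_pos|]. apply Rpower_le_exp; auto. pose proof (Rmax_l tau (INR J)); lra.
      - destruct (Nat.le_gt_cases J k) as [h|h].
        + replace (J - k)%nat with O by lia. unfold taylor; simpl. rewrite Rabs_R0.
          apply Rmult_le_pos; auto. left; apply Rpower_pos.
        + apply Rle_trans with (1 := H2 x Hx). apply Rmult_le_compat_l; auto.
          rewrite <- Rpower_pow by lra. apply Rpower_le_exp; auto. rewrite minus_INR by lia.
          pose proof (Rmax_r tau (INR J)). pose proof (pos_INR k). nra. }
    destruct H0 as [C0 [HC0 H0]]. destruct H1 as [C1 [HC1 H1]].
    exists (C0 + C1). intros x Hx. unfold weight. destruct (Rle_dec x 1) as [h|h].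
    + apply Rle_trans with (1 := H0 x ltac:(lra)). apply Rmult_le_compat_r; [left; apply Rpower_pos|lra].
    + apply Rle_trans with (1 := H1 x ltac:(lra)). apply Rmult_le_compat_r; [left; apply Rpower_pos|lra].
Qed.

(** * Asymptotic expansion on the half-line *)

Definition half_coef (d : nat) (F : nat -> R -> R) (lam th : R) (j : nat) : R :=
  let al := INR (S j) / INR (S d) in
  F j 0 / INR (fact j) * (cos (th + al * (PI / 2)) * (Gamma al / INR (S d) * Rpower lam (- al))).

Lemma osc_limit_taylor (d : nat) (F : nat -> R -> R) (lam th : R) (psi : R -> R) (J : nat) :
  0 < lam -> (forall n, rapid n psi) ->
  osc_limit (S d) (at_right 0) (Rbar_locally p_infty) lam th (taylor F 0 J) psi
    (psi 0 * psum (half_coef d F lam th) J).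
Proof.
  intros Hlam Hpsi.
  assert (Hm := fun j => osc_limit_monomial d j lam th psi Hlam Hpsi). cbv beta zeta in Hm.
  induction J.
  (* The zero function is written as a combination of monomials, so that linearity covers it. *)
  - apply (osc_limit_ext _ _ _ _ _ (fun x => 0 * x ^ 0 + 0 * x ^ 0)).
    { intros x. unfold taylor; simpl. ring. }
    replace (psi 0 * psum (half_coef d F lam th) 0) with
      (0 * (psi 0 * (cos (th + INR 1 / INR (S d) * (PI / 2)) * (Gamma (INR 1 / INR (S d)) / INR (S d) * Rpower lam (- (INR 1 / INR (S d))))))
       + 0 * (psi 0 * (cos (th + INR 1 / INR (S d) * (PI / 2)) * (Gamma (INR 1 / INR (S d)) / INR (S d) * Rpower lam (- (INR 1 / INR (S d)))))))
      by (simpl psum; ring).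
    apply (osc_limit_lin (S d) (at_right 0) (Rbar_locally p_infty)); apply (Hm O).
  - apply (osc_limit_ext _ _ _ _ _ (fun x => 1 * taylor F 0 J x + F J 0 / INR (fact J) * x ^ J)).
    { intros x. unfold taylor. simpl. ring. }
    replace (psi 0 * psum (half_coef d F lam th) (S J)) with
      (1 * (psi 0 * psum (half_coef d F lam th) J) + F J 0 / INR (fact J) *
        (psi 0 * (cos (th + INR (S J) / INR (S d) * (PI / 2)) * (Gamma (INR (S J) / INR (S d)) / INR (S d) * Rpower lam (- (INR (S J) / INR (S d)))))))
      by (simpl psum; unfold half_coef; ring).
    apply (osc_limit_lin (S d) (at_right 0) (Rbar_locally p_infty)); auto.
Qed.

Lemma half_coef_bound (d : nat) (F : nat -> R -> R) (j : nat) (p : R) : p <= INR (S j) / INR (S d) ->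
  exists C, 0 <= C /\ forall lam th, 1 <= lam -> Rabs (half_coef d F lam th j) <= C * Rpower lam (- p).
Proof.
  intros Hp. unfold half_coef. set (al := INR (S j) / INR (S d)) in *.
  exists (Rabs (F j 0 / INR (fact j)) * Rabs (Gamma al / INR (S d))).
  split; [apply Rmult_le_pos; apply Rabs_pos|].
  intros lam th Hl. rewrite !(Rabs_mult _ (_ * _)), (Rabs_mult (Gamma al / _)), Rmult_assoc.
  apply Rmult_le_compat_l; [apply Rabs_pos|].
  rewrite <- (Rmult_1_l (Rabs (Gamma al / INR (S d)) * Rpower lam (- p))).
  apply Rmult_le_compat; try apply Rabs_pos.
  - apply Rmult_le_pos; apply Rabs_pos.
  - apply Rabs_le, COS_bound.
  - apply Rmult_le_compat_l; [apply Rabs_pos|].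
    rewrite Rabs_pos_eq by (left; apply Rpower_pos). apply Rpower_le_exp; auto. lra.
Qed.

(** For lam >= 1 every later power of lam is dominated by the first omitted one. This is what allows
    the Taylor polynomial to be longer than the expansion. *)
Lemma half_psum_tail (d : nat) (F : nat -> R -> R) (M q : nat) :
  exists C, 0 <= C /\ forall lam th, 1 <= lam ->
    Rabs (psum (half_coef d F lam th) (M + q) - psum (half_coef d F lam th) M)
      <= C * Rpower lam (- (INR (S M) / INR (S d))).
Proof.
  assert (Hm : 0 < INR (S d)) by (apply lt_0_INR; lia).
  induction q.
  - exists 0. split; [lra|]. intros. rewrite Nat.add_0_r, Rminus_diag, Rabs_R0. lra.
  - destruct IHq as [C1 [HC1 H1]].
    destruct (half_coef_bound d F (M + q) (INR (S M) / INR (S d))) as [C2 [HC2 H2]].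
    { apply Rmult_le_compat_r; [left; apply Rinv_0_lt_compat; auto|]. apply le_INR. lia. }
    exists (C1 + C2). split; [lra|]. intros lam th Hl. rewrite Nat.add_succ_r. simpl psum.
    specialize (H1 lam th Hl). specialize (H2 lam th Hl).
    replace (psum (half_coef d F lam th) (M + q) + half_coef d F lam th (M + q) - psum (half_coef d F lam th) M)
      with ((psum (half_coef d F lam th) (M + q) - psum (half_coef d F lam th) M) + half_coef d F lam th (M + q)) by ring.
    eapply Rle_trans; [apply Rabs_triang|]. lra.
Qed.

(** [E] must be fixed before [M], so it is taken from the amplitude itself, with no vanishing at 0
    and hence no decay in lam. For each [M] a separate splitting into Taylor polynomial and
    remainder gives the decay, and uniqueness of the limit for the single cutoff [chi], with chi(0)
    = 1, identifies the two values. *)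
Lemma half_line_expansion (d : nat) (delta tau : R) (F : nat -> R -> R) :
  -1 <= delta < INR d ->
  (forall k x, is_derive (F k) x (F (S k) x)) ->
  (forall k, exists C, forall x, 1 <= x -> Rabs (F k x) <= C * Rpower x (tau + delta * INR k)) ->
  exists E : R -> R -> R,
    (forall lam th psi, 0 < lam -> (forall n, rapid n psi) ->
       osc_limit (S d) (at_right 0) (Rbar_locally p_infty) lam th (F O) psi (psi 0 * E lam th)) /\
    forall M : nat, exists C, forall lam th, 1 <= lam ->
      Rabs (E lam th - psum (half_coef d F lam th) M) <= C * Rpower lam (- (INR (S M) / INR (S d))).
Proof.
  intros Hd HF HB.
  assert (Hkap : 0 < INR d - delta) by lra.
  set (chi := fun t => t ^ 0 * exp (- (1 * t ^ S d))).
  assert (Hchi : forall n, rapid n chi) by (intros; apply rapid_monomial_exp).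
  assert (Hchi0 : chi 0 = 1) by (unfold chi; rewrite (pow_i (S d)) by lia; rewrite Rmult_0_r, Ropp_0, exp_0; simpl; ring).
  assert (HE : forall lam th, exists E, 0 < lam -> forall psi, (forall n, rapid n psi) ->
     osc_limit (S d) (at_right 0) (Rbar_locally p_infty) lam th (F O) psi (psi 0 * E)).
  { intros lam th. destruct (Rlt_dec 0 lam) as [Hl|Hl]; [|exists 0; tauto].
    destruct (order_ex _ (Rmax tau (INR 0)) Hkap) as [N HN].
    pose proof (taylor_remainder_symbol F delta tau N 0 (proj1 Hd) HF HB) as Hs.
    destruct (osc_limit_half_line d delta 0 Hd N (Rmax tau (INR 0)) (fun x => F O x - taylor F 0 0 x)) as [C [_ H]]; auto.
    { replace (INR 0 * INR (S d)) with (INR 0) by (simpl INR; ring). exact Hs. }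
    destruct (H lam th Hl) as [E [_ HE]]. exists E. intros _ psi Hpsi.
    apply (osc_limit_ext _ _ _ _ _ (fun x => F O x - taylor F 0 0 x)); [|apply HE; auto].
    intros x. unfold taylor; simpl. ring. }
  exists (fun lam th => proj1_sig (constructive_indefinite_description _ (HE lam th))).
  split.
  - intros lam th psi Hl Hpsi. destruct (constructive_indefinite_description _ (HE lam th)) as [E H]. simpl. auto.
  - intros M.
    (* M + 1 integrations by parts give lam^(-(M+1)), which is at most lam^(-(M+1)/m) for lam >= 1;
       they require a remainder of order J = (M+1) m, and J >= M leaves only a tail to absorb. *)
    set (n := S M). set (J := (n * S d)%nat).
    destruct (order_ex _ (Rmax tau (INR J)) Hkap) as [N HN].
    pose proof (taylor_remainder_symbol F delta tau (n + N) J (proj1 Hd) HF HB) as Hs.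
    destruct (osc_limit_half_line d delta n Hd N (Rmax tau (INR J)) (fun x => F O x - taylor F 0 J x)) as [C1 [HC1 H1]].
    { unfold J in *. rewrite mult_INR in *. exact Hs. }
    { apply Rle_trans with (1 := HN). apply Rplus_le_compat_l. apply Rmult_le_compat_r; [lra|]. apply le_INR; lia. }
    destruct (half_psum_tail d F M (J - M)) as [C2 [HC2 H2]].
    replace (M + (J - M))%nat with J in H2 by (unfold J, n; nia).
    exists (C1 + C2). intros lam th Hl.
    destruct (constructive_indefinite_description _ (HE lam th)) as [E H]. cbn [proj1_sig].
    destruct (H1 lam th ltac:(lra)) as [ER [HER OR]]. specialize (HER Hl). specialize (H2 lam th Hl).
    assert (EE : E = psum (half_coef d F lam th) J + ER).
    { pose proof (osc_limit_taylor d F lam th chi J ltac:(lra) Hchi) as O1.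
      pose proof (OR chi (Hchi _)) as O2.
      pose proof (osc_limit_lin _ _ _ _ _ _ _ _ 1 1 _ _ O1 O2) as O3.
      assert (O4 : osc_limit (S d) (at_right 0) (Rbar_locally p_infty) lam th (F O) chi
        (1 * (chi 0 * psum (half_coef d F lam th) J) + 1 * (chi 0 * ER))).
      { refine (osc_limit_ext _ _ _ _ _ _ _ _ _ _ O3). intros x; ring. }
      assert (Hl0 : 0 < lam) by lra.
      pose proof (osc_limit_unique (S d) (at_right 0) (Rbar_locally p_infty) _ _ _ _ _ _ (H Hl0 chi Hchi) O4) as K.
      rewrite Hchi0 in K. lra. }
    assert (Hpow : / lam ^ n <= Rpower lam (- (INR (S M) / INR (S d)))).
    { rewrite <- Rpower_pow, <- Rpower_Ropp by lra. apply Rpower_le_exp; auto.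
      apply Ropp_le_contravar. fold n. pose proof (pos_INR n).
      assert (1 <= INR (S d)) by (rewrite S_INR; pose proof (pos_INR d); lra).
      apply (Rmult_le_reg_r (INR (S d))); [lra|]. unfold Rdiv. rewrite Rmult_assoc, Rinv_l by lra. nra. }
    rewrite EE.
    replace (psum (half_coef d F lam th) J + ER - psum (half_coef d F lam th) M)
      with ((psum (half_coef d F lam th) J - psum (half_coef d F lam th) M) + ER) by ring.
    eapply Rle_trans; [apply Rabs_triang|].
    assert (C1 * / lam ^ n <= C1 * Rpower lam (- (INR (S M) / INR (S d)))) by (apply Rmult_le_compat_l; auto).
    unfold n in *. lra.
Qed.

(** * From the half-line to the line *)

(** Two half-lines are joined by additivity at a point, while the half-line results are stated at
    0+; for a continuous integrand the missing piece [0, a] has integral O(a). *)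
Lemma is_RInt_gen_at_right_point (g : R -> R) (l : R) : (forall x, continuous g x) ->
  is_RInt_gen g (at_right 0) (Rbar_locally p_infty) l ->
  is_RInt_gen g (at_point 0) (Rbar_locally p_infty) l.
Proof.
  intros Hc H. apply is_RInt_gen_lim in H; try typeclasses eauto.
  assert (HE : forall a b, ex_RInt g a b) by (intros; apply cont_ex_RInt; auto).
  apply (filterlimi_lim_ext_loc (fun ab : R * R => RInt g (fst ab) (snd ab))).
  { apply filter_forall. intros ab. apply (RInt_correct (V := R_CompleteNormedModule)); auto. }
  apply filterlim_Rabs_lt; [typeclasses eauto|]. intros e He.
  destruct (continuous_bounded_01 g Hc) as [K [HK HgK]].
  destruct (proj1 (filterlim_Rabs_lt _ _ _) H (e / 2) ltac:(lra)) as [Q S HQ HS HQS].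
  assert (Hd : 0 < Rmin 1 (e / (2 * (K + 1)))) by (apply Rmin_pos; [lra|apply Rdiv_lt_0_compat; lra]).
  assert (Hsmall : at_right 0 (fun a => 0 < a < Rmin 1 (e / (2 * (K + 1))))).
  { exists (mkposreal _ Hd). intros y Hy Hy0. change (Rabs (y - 0) < Rmin 1 (e / (2 * (K + 1)))) in Hy.
    rewrite Rminus_0_r, Rabs_pos_eq in Hy; lra. }
  destruct (filter_ex _ (filter_and _ _ HQ Hsmall)) as [a [Qa [Ha0 Ha]]].
  pose proof (Rmin_l 1 (e / (2 * (K + 1)))) as H1. pose proof (Rmin_r 1 (e / (2 * (K + 1)))) as H2.
  apply (Filter_prod _ _ _ (fun x => x = 0) S); [reflexivity|exact HS|].
  intros x b -> Hb. simpl fst; simpl snd.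
  specialize (HQS a b Qa Hb). simpl in HQS.
  pose proof (RInt_Chasles (V := R_CompleteNormedModule) g 0 a b (HE _ _) (HE _ _)) as E1.
  unfold plus in E1; simpl in E1.
  assert (B : Rabs (RInt g 0 a) <= (a - 0) * K).
  { apply abs_RInt_le_const; auto; [lra|]. intros t Ht. apply HgK. lra. }
  assert (H3 : a < e / (2 * (K + 1))) by lra.
  assert (H4 : a * (2 * (K + 1)) < e).
  { apply (Rmult_lt_compat_r (2 * (K + 1))) in H3; [|lra].
    replace (e / (2 * (K + 1)) * (2 * (K + 1))) with e in H3 by (field; lra). exact H3. }
  replace (RInt g 0 b - l) with (RInt g 0 a + (RInt g a b - l)) by lra.
  eapply Rle_lt_trans; [apply Rabs_triang|]. nra.
Qed.

Lemma is_RInt_gen_reflect (g : R -> R) (l : R) : (forall x, continuous g x) ->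
  is_RInt_gen (fun x => g (- x)) (at_point 0) (Rbar_locally p_infty) l ->
  is_RInt_gen g (Rbar_locally m_infty) (at_point 0) l.
Proof.
  intros Hc H. apply is_RInt_gen_lim in H; try typeclasses eauto.
  assert (HE : forall a b, ex_RInt g a b) by (intros; apply cont_ex_RInt; auto).
  apply (filterlimi_lim_ext_loc (fun ab : R * R => RInt g (fst ab) (snd ab))).
  { apply filter_forall. intros ab. apply (RInt_correct (V := R_CompleteNormedModule)); auto. }
  apply filterlim_Rabs_lt; [typeclasses eauto|]. intros e He.
  destruct (proj1 (filterlim_Rabs_lt _ _ _) H e He) as [Q S HQ [B HB] HQS].
  apply (Filter_prod _ _ _ (fun x => x < - B) (fun x => x = 0)); [exists (- B); auto|reflexivity|].
  intros a x Ha ->. simpl fst; simpl snd.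
  specialize (HQS 0 (- a) HQ (HB (- a) ltac:(lra))). simpl in HQS.
  replace (RInt g a 0) with (RInt (fun x => g (- x)) 0 (- a)); auto.
  apply (is_RInt_unique (V := R_CompleteNormedModule)).
  assert (H1 : is_RInt g (- - a) (- 0) (RInt g a 0)).
  { rewrite Ropp_involutive, Ropp_0. apply (RInt_correct (V := R_CompleteNormedModule)); auto. }
  apply (is_RInt_comp_opp (V := R_NormedModule)) in H1.
  apply (is_RInt_swap (V := R_NormedModule)) in H1.
  apply (is_RInt_opp (V := R_NormedModule)) in H1.
  change (is_RInt (fun x => - - g (- x)) 0 (- a) (- - RInt g a 0)) in H1.
  rewrite Ropp_involutive in H1.
  apply (is_RInt_ext (V := R_NormedModule) (fun x => - - g (- x))); auto.
  intros; apply Ropp_involutive.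
Qed.

(** [th'] carries the parity of m: for odd m, evenness of the cosine moves the sign of the reflected
    phase onto [th]. *)
Lemma osc_limit_line m lam th th' f psi E1 E2 :
  (forall x, continuous f x) -> (forall x, continuous psi x) ->
  (forall x, cos (lam * (- x) ^ m + th) = cos (lam * x ^ m + th')) ->
  osc_limit m (at_right 0) (Rbar_locally p_infty) lam th f psi E1 ->
  osc_limit m (at_right 0) (Rbar_locally p_infty) lam th' (fun x => f (- x)) (fun t => psi (- t)) E2 ->
  osc_limit m (Rbar_locally m_infty) (Rbar_locally p_infty) lam th f psi (E1 + E2).
Proof.
  intros Hf Hp Hcos [J1 [H1 L1]] [J2 [H2 L2]].
  exists (fun e => J2 e + J1 e). split.
  - intros eps He.
    set (g := fun x => cos (lam * x ^ m + th) * (f x * psi (eps * x))).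
    assert (Hg : forall x, continuous g x).
    { intros x. apply (cont_mult (fun x => cos (lam * x ^ m + th)) (fun x => f x * psi (eps * x))).
      - apply continuous_phase.
      - apply cont_mult; auto. apply continuous_dilation; auto. }
    apply (is_RInt_gen_Chasles (V := R_NormedModule) g 0).
    + apply is_RInt_gen_reflect; auto. apply is_RInt_gen_at_right_point.
      * intros x. apply (continuous_comp (fun x => - x) g); auto.
        apply (ex_derive_continuous (fun x => - x)). auto_derive; trivial.
      * apply (is_RInt_gen_ext (V := R_NormedModule) (fun x => cos (lam * x ^ m + th') * (f (- x) * psi (- (eps * x))))); auto.
        apply filter_forall. intros ab x _. unfold g. rewrite Hcos, Ropp_mult_distr_r. reflexivity.
    + apply is_RInt_gen_at_right_point; auto. apply H1; exact He.
  - rewrite Rplus_comm. apply (filterlim_comp_2 J2 J1 Rplus L2 L1). apply (filterlim_plus (V := R_NormedModule)).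
Qed.

Definition reflect (F : nat -> R -> R) (k : nat) (x : R) : R := (-1) ^ k * F k (- x).

Lemma is_derive_reflect F : (forall k x, is_derive (F k) x (F (S k) x)) ->
  forall k x, is_derive (reflect F k) x (reflect F (S k) x).
Proof.
  intros HF k x. unfold reflect. auto_derive.
  - exists (F (S k) (- x)). apply HF.
  - replace (Derive (fun x0 => F k x0) (- x)) with (F (S k) (- x)) by (symmetry; apply is_derive_unique, HF).
    simpl pow. ring.
Qed.

(** The second cosine comes from x < 0: (-1)^j from the derivatives of the reflected amplitude,
    (-1)^m on [th] from the reflected phase. For even m the odd-index coefficients cancel. *)
Definition line_coef (d : nat) (F : nat -> R -> R) (lam th : R) (j : nat) : R :=
  let al := INR (S j) / INR (S d) in
  F j 0 / INR (fact j) * ((cos (th + al * (PI / 2)) + (-1) ^ j * cos ((-1) ^ S d * th + al * (PI / 2)))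
    * (Gamma al / INR (S d) * Rpower lam (- al))).

Lemma psum_plus c c' n : psum (fun j => c j + c' j) n = psum c n + psum c' n.
Proof. induction n; simpl; [ring|]. rewrite IHn. ring. Qed.

Lemma psum_ext c c' n : (forall j, c j = c' j) -> psum c n = psum c' n.
Proof. intros H. induction n; simpl; auto. rewrite IHn, H. reflexivity. Qed.

Lemma psum_line_coef d F lam th n :
  psum (line_coef d F lam th) n =
  psum (half_coef d F lam th) n + psum (half_coef d (reflect F) lam ((-1) ^ S d * th)) n.
Proof.
  rewrite <- psum_plus. apply psum_ext. intros j. unfold line_coef, half_coef, reflect.
  rewrite Ropp_0. field. split; [apply not_0_INR; lia|apply INR_fact_neq_0].
Qed.

Lemma line_expansion (d : nat) (delta tau : R) (F : nat -> R -> R) :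
  -1 <= delta < INR d ->
  (forall k x, is_derive (F k) x (F (S k) x)) ->
  (forall k, exists C, forall x, 1 <= Rabs x -> Rabs (F k x) <= C * Rpower (Rabs x) (tau + delta * INR k)) ->
  exists E : R -> R -> R,
    (forall lam th psi, 0 < lam -> (forall n, rapid n psi) -> (forall n, rapid n (fun t => psi (- t))) ->
       osc_limit (S d) (Rbar_locally m_infty) (Rbar_locally p_infty) lam th (F O) psi (psi 0 * E lam th)) /\
    forall M : nat, exists C, forall lam th, 1 <= lam ->
      Rabs (E lam th - psum (line_coef d F lam th) M) <= C * Rpower lam (- (INR (S M) / INR (S d))).
Proof.
  intros Hd HF HB.
  destruct (half_line_expansion d delta tau F Hd HF) as [E1 [O1 A1]].
  { intros k. destruct (HB k) as [C HC]. exists C. intros x Hx. specialize (HC x).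
    rewrite (Rabs_pos_eq x) in HC by lra. auto. }
  destruct (half_line_expansion d delta tau (reflect F) Hd (is_derive_reflect F HF)) as [E2 [O2 A2]].
  { intros k. destruct (HB k) as [C HC]. exists C. intros x Hx. specialize (HC (- x)).
    rewrite Rabs_Ropp, (Rabs_pos_eq x) in HC by lra. unfold reflect.
    rewrite Rabs_mult, pow_1_abs, Rmult_1_l. auto. }
  exists (fun lam th => E1 lam th + E2 lam ((-1) ^ S d * th)). split.
  - intros lam th psi Hl Hp Hp'. rewrite Rmult_plus_distr_l.
    apply (osc_limit_line _ _ _ ((-1) ^ S d * th)); auto.
    + intros x. apply (is_derive_cont _ _ _ (HF O x)).
    + apply (rapid_continuous O). apply Hp.
    + intros x. replace (- x) with (-1 * x) by ring. rewrite Rpow_mult_distr.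
      destruct (Nat.Even_or_Odd (S d)) as [[k Hk]|[k Hk]]; rewrite Hk.
      * rewrite pow_1_even. f_equal. ring.
      * rewrite Nat.add_1_r, pow_1_odd. rewrite <- cos_neg. f_equal. ring.
    + replace (psi 0) with ((fun t => psi (- t)) 0) by (rewrite Ropp_0; reflexivity).
      apply (osc_limit_ext _ _ _ _ _ (reflect F O)).
      * intros x. unfold reflect. simpl. ring.
      * apply (O2 lam _ (fun t => psi (- t))); auto.
  - intros M. destruct (A1 M) as [C1 H1]. destruct (A2 M) as [C2 H2]. exists (C1 + C2).
    intros lam th Hl. specialize (H1 lam th Hl). specialize (H2 lam ((-1) ^ S d * th) Hl).
    rewrite psum_line_coef.
    replace (E1 lam th + E2 lam ((-1) ^ S d * th) -
      (psum (half_coef d F lam th) M + psum (half_coef d (reflect F) lam ((-1) ^ S d * th)) M))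
    with ((E1 lam th - psum (half_coef d F lam th) M) +
      (E2 lam ((-1) ^ S d * th) - psum (half_coef d (reflect F) lam ((-1) ^ S d * th)) M)) by ring.
    eapply Rle_trans; [apply Rabs_triang|]. lra.
Qed.

(** * Complex amplitudes *)

Lemma C_ball (u v : C) (eps : posreal) :
  Rabs (fst v - fst u) < eps -> Rabs (snd v - snd u) < eps -> ball (M := C_R_NormedModule) u eps v.
Proof. intros H1 H2. split; [exact H1|exact H2]. Qed.

Lemma is_RInt_gen_pair (Fa Fb : (R -> Prop) -> Prop) {FFa : Filter Fa} {FFb : Filter Fb} (f1 f2 : R -> R) (l1 l2 : R) :
  is_RInt_gen f1 Fa Fb l1 -> is_RInt_gen f2 Fa Fb l2 ->
  is_RInt_gen (V := C_R_NormedModule) (fun x => (f1 x, f2 x)) Fa Fb (l1, l2).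
Proof.
  intros H1 H2 P [eps HP].
  assert (B1 : locally l1 (fun y : R => Rabs (y - l1) < eps)) by (exists eps; intros y Hy; exact Hy).
  assert (B2 : locally l2 (fun y : R => Rabs (y - l2) < eps)) by (exists eps; intros y Hy; exact Hy).
  specialize (H1 _ B1). specialize (H2 _ B2). unfold filtermapi in *.
  eapply filter_imp; [|exact (filter_and _ _ H1 H2)].
  intros ab [[y1 [I1 L1]] [y2 [I2 L2]]]. exists (y1, y2). split.
  - apply (is_RInt_fct_extend_pair (U := R_NormedModule) (V := R_NormedModule) (fun x => (f1 x, f2 x))); auto.
  - apply HP. apply C_ball; auto.
Qed.

Lemma filterlim_pair_C {T : Type} (F : (T -> Prop) -> Prop) {FF : Filter F} (f1 f2 : T -> R) (l1 l2 : R) :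
  filterlim f1 F (locally l1) -> filterlim f2 F (locally l2) ->
  filterlim (fun t => (f1 t, f2 t)) F (locally (T := C_R_NormedModule) (l1, l2)).
Proof.
  intros H1 H2 P [eps HP]. unfold filtermap.
  eapply filter_imp; [|exact (filter_and _ _ (proj1 (filterlim_Rabs_lt F f1 l1) H1 _ (cond_pos eps))
                                (proj1 (filterlim_Rabs_lt F f2 l2) H2 _ (cond_pos eps)))].
  intros t [A B]. apply HP. apply C_ball; auto.
Qed.

Lemma is_derive_Derive_n (f : R -> R) : (forall n x, ex_derive_n f n x) ->
  forall k x, is_derive (Derive_n f k) x (Derive_n f (S k) x).
Proof. intros H k x. apply Derive_correct. apply (H (S k) x). Qed.

Lemma Cmod_ge_fst (z : C) : Rabs (fst z) <= Cmod z.
Proof. apply Rle_trans with (2 := Rmax_Cmod z). apply Rmax_l. Qed.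

Lemma Cmod_ge_snd (z : C) : Rabs (snd z) <= Cmod z.
Proof. apply Rle_trans with (2 := Rmax_Cmod z). apply Rmax_r. Qed.

Lemma Cmod_le_sum (z : C) : Cmod z <= Rabs (fst z) + Rabs (snd z).
Proof.
  unfold Cmod. rewrite <- (pow2_abs (fst z)), <- (pow2_abs (snd z)).
  pose proof (Rabs_pos (fst z)). pose proof (Rabs_pos (snd z)).
  rewrite <- (sqrt_pow2 (Rabs (fst z) + Rabs (snd z))) by lra.
  apply sqrt_le_1_alt. nra.
Qed.

Lemma rapid_of_Derive_n (f : R -> R) :
  (forall n x, ex_derive_n f n x) ->
  (forall j k : nat, exists M, forall x, Rabs x ^ j * Rabs (Derive_n f k x) <= M) ->
  (forall n, rapid n f) /\ (forall n, rapid n (fun t => f (- t))).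
Proof.
  intros Hs HB. split; intros n.
  - apply (rapid_of_derivatives n (Derive_n f)).
    + apply is_derive_Derive_n; auto.
    + intros k j. destruct (HB j k) as [M HM]. exists M. intros t Ht. specialize (HM t).
      rewrite (Rabs_pos_eq t Ht) in HM. exact HM.
  - replace (fun t => f (- t)) with (reflect (Derive_n f) O).
    + apply (rapid_of_derivatives n (reflect (Derive_n f))).
      * apply is_derive_reflect, is_derive_Derive_n; auto.
      * intros k j. destruct (HB j k) as [M HM]. exists M. intros t Ht. specialize (HM (- t)).
        rewrite Rabs_Ropp, (Rabs_pos_eq t Ht) in HM. unfold reflect.
        rewrite Rabs_mult, pow_1_abs, Rmult_1_l. exact HM.
    + apply functional_extensionality. intros t. unfold reflect. simpl. ring.
Qed.

(** Since [rapid] looks at t >= 0 only, the negative half of the line enters through the reflected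
    cutoff. *)
Lemma schwartz_components (chi : R -> C) : schwartz chi ->
  ((forall n, rapid n (fun t => fst (chi t))) /\ (forall n, rapid n (fun t => fst (chi (- t))))) /\
  ((forall n, rapid n (fun t => snd (chi t))) /\ (forall n, rapid n (fun t => snd (chi (- t))))).
Proof.
  intros [Hs HB]. split.
  - apply (rapid_of_Derive_n (fun t => fst (chi t))).
    + intros n x. apply Hs.
    + intros j k. destruct (HB j k) as [M HM]. exists M. intros x. apply Rle_trans with (2 := HM x).
      apply Rmult_le_compat_l; [apply pow_le, Rabs_pos|]. apply (Cmod_ge_fst (Cderive_n chi k x)).
  - apply (rapid_of_Derive_n (fun t => snd (chi t))).
    + intros n x. apply Hs.
    + intros j k. destruct (HB j k) as [M HM]. exists M. intros x. apply Rle_trans with (2 := HM x).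
      apply Rmult_le_compat_l; [apply pow_le, Rabs_pos|]. apply (Cmod_ge_snd (Cderive_n chi k x)).
Qed.

(** For |x| >= 1 one has |x| <= [japanese x] <= sqrt 2 |x|; the upper bound serves y >= 0 and the
    lower one y < 0. *)
Lemma japanese_Rpower (y : R) : exists K, 0 <= K /\ forall x, 1 <= Rabs x ->
  Rpower (japanese x) y <= K * Rpower (Rabs x) y.
Proof.
  exists (Rmax 1 (Rpower (sqrt 2) y)).
  split; [apply Rle_trans with 1; [lra|apply Rmax_l]|].
  intros x Hx. unfold japanese. rewrite <- (pow2_abs x). set (t := Rabs x) in *.
  assert (H2 : 0 < sqrt 2) by (apply sqrt_lt_R0; lra).
  assert (L : t <= sqrt (1 + t ^ 2)).
  { rewrite <- (sqrt_pow2 t) at 1 by lra. apply sqrt_le_1_alt. lra. }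
  destruct (Rle_dec 0 y) as [Hy|Hy].
  - apply Rle_trans with (Rpower (sqrt 2) y * Rpower t y).
    + rewrite Rpower_mult_distr by lra. apply Rle_Rpower_l; auto. split; [lra|].
      rewrite <- (sqrt_pow2 t) at 2 by lra. rewrite <- sqrt_mult by nra.
      apply sqrt_le_1_alt. nra.
    + apply Rmult_le_compat_r; [left; apply Rpower_pos|apply Rmax_r].
  - apply Rle_trans with (1 * Rpower t y).
    + rewrite Rmult_1_l. replace y with (- - y) by ring. rewrite !(Rpower_Ropp _ (- y)).
      apply Rinv_le_contravar; [apply Rpower_pos|]. apply Rle_Rpower_l; lra.
    + apply Rmult_le_compat_r; [left; apply Rpower_pos|apply Rmax_l].
Qed.

Lemma amplitude_bound tau delta a : amplitude tau delta a ->
  forall k, exists C0, forall x, 1 <= Rabs x ->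
    Cmod (Cderive_n a k x) <= C0 * Rpower (Rabs x) (tau + delta * INR k).
Proof.
  intros [_ H] k. destruct (H k) as [Ck [HCk HB]].
  destruct (japanese_Rpower (tau + delta * INR k)) as [K [HK HK']].
  exists (Ck * K). intros x Hx. apply Rle_trans with (1 := HB x). rewrite Rmult_assoc.
  apply Rmult_le_compat_l; [lra|auto].
Qed.

Lemma is_RInt_gen_lincomb (Fa Fb : (R -> Prop) -> Prop) {FFa : Filter Fa} {FFb : Filter Fb} (f g : R -> R) (c lf lg : R) :
  is_RInt_gen f Fa Fb lf -> is_RInt_gen g Fa Fb lg ->
  is_RInt_gen (fun x => f x + c * g x) Fa Fb (lf + c * lg).
Proof.
  intros Hf Hg. apply (is_RInt_gen_plus (V := R_NormedModule) f (fun x => c * g x)); auto.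
  apply (is_RInt_gen_scal (V := R_NormedModule) g c); auto.
Qed.

Lemma filterlim_lincomb {T : Type} (F : (T -> Prop) -> Prop) {FF : Filter F} (f g : T -> R) (c lf lg : R) :
  filterlim f F (locally lf) -> filterlim g F (locally lg) ->
  filterlim (fun x => f x + c * g x) F (locally (lf + c * lg)).
Proof.
  intros Hf Hg. apply (filterlim_comp_2 f (fun x => c * g x) Rplus (G := locally lf) (H := locally (c * lg))); auto.
  - apply (filterlim_comp _ _ _ g (fun x => c * x) _ (locally lg)); auto.
    apply (filterlim_scal_r (V := R_NormedModule) c lg).
  - apply (filterlim_plus (V := R_NormedModule)).
Qed.

(* [e^{-i pi/2}] turns cosines into sines, so the angles 0 and -pi/2 give the
   real and imaginary parts of the exponential. *)
Definition complex_coef (s : R) (d : nat) (a : R -> C) (lam : R) (j : nat) : C :=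
  let F1 := Derive_n (fun t => Re (a t)) in
  let F2 := Derive_n (fun t => Im (a t)) in
  (line_coef d F1 lam 0 j - s * line_coef d F2 lam (- (PI / 2)) j,
   line_coef d F2 lam 0 j + s * line_coef d F1 lam (- (PI / 2)) j).

Lemma fst_sum_n (u : nat -> C) n : fst (sum_n (G := C_AbelianGroup) u n) = sum_n (fun k => fst (u k)) n.
Proof. induction n; [rewrite !sum_O; auto|]. rewrite !sum_Sn, <- IHn. reflexivity. Qed.

Lemma snd_sum_n (u : nat -> C) n : snd (sum_n (G := C_AbelianGroup) u n) = sum_n (fun k => snd (u k)) n.
Proof. induction n; [rewrite !sum_O; auto|]. rewrite !sum_Sn, <- IHn. reflexivity. Qed.

(** The product of the exponential, [a] and [chi] expands into eight real integrals. Those with the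
    imaginary part of [chi] tend to multiples of Im chi(0) = 0, so the limit depends on [a]
    alone. *)
Lemma Os_int_expansion (d : nat) (tau delta : R) (a : R -> C) (s : R) :
  -1 <= delta < INR d -> amplitude tau delta a -> s = 1 \/ s = -1 ->
  exists I : R -> C,
    (forall lam, 0 < lam -> is_Os_int s lam (S d) a (I lam)) /\
    forall M, exists C0, forall lam, 1 <= lam ->
      Cmod (I lam - sum_n (G := C_AbelianGroup) (complex_coef s d a lam) M)%C
        <= C0 * Rpower lam (- (INR (S (S M)) / INR (S d))).
Proof.
  intros Hd Ha Hs.
  set (F1 := Derive_n (fun t => Re (a t))). set (F2 := Derive_n (fun t => Im (a t))).
  pose proof (amplitude_bound _ _ _ Ha) as HB. destruct Ha as [Hsm _].
  destruct (line_expansion d delta tau F1 Hd) as [W1 [O1 A1]].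
  { apply is_derive_Derive_n. intros n x. apply Hsm. }
  { intros k. destruct (HB k) as [C0 H]. exists C0. intros x Hx. apply Rle_trans with (2 := H x Hx).
    apply (Cmod_ge_fst (Cderive_n a k x)). }
  destruct (line_expansion d delta tau F2 Hd) as [W2 [O2 A2]].
  { apply is_derive_Derive_n. intros n x. apply Hsm. }
  { intros k. destruct (HB k) as [C0 H]. exists C0. intros x Hx. apply Rle_trans with (2 := H x Hx).
    apply (Cmod_ge_snd (Cderive_n a k x)). }
  assert (Hsabs : Rabs s = 1) by (destruct Hs; subst; [apply Rabs_R1|rewrite Rabs_left; lra]).
  exists (fun lam => (W1 lam 0 - s * W2 lam (- (PI / 2)), W2 lam 0 + s * W1 lam (- (PI / 2)))).
  split.
  - intros lam Hlam chi Hchi Hchi0.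
    destruct (schwartz_components chi Hchi) as [[R1 R1'] [R2 R2']].
    assert (E1 : fst (chi 0) = 1) by (rewrite Hchi0; reflexivity).
    assert (E2 : snd (chi 0) = 0) by (rewrite Hchi0; reflexivity).
    (* The first index is the component of [a], the second that of [chi]; [J] belongs to the angle 0
       and [K] to -pi/2. *)
    destruct (O1 lam 0 _ Hlam R1 R1') as [J11 [H11 L11]].
    destruct (O1 lam 0 _ Hlam R2 R2') as [J12 [H12 L12]].
    destruct (O2 lam 0 _ Hlam R1 R1') as [J21 [H21 L21]].
    destruct (O2 lam 0 _ Hlam R2 R2') as [J22 [H22 L22]].
    destruct (O1 lam (- (PI / 2)) _ Hlam R1 R1') as [K11 [G11 N11]].
    destruct (O1 lam (- (PI / 2)) _ Hlam R2 R2') as [K12 [G12 N12]].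
    destruct (O2 lam (- (PI / 2)) _ Hlam R1 R1') as [K21 [G21 N21]].
    destruct (O2 lam (- (PI / 2)) _ Hlam R2 R2') as [K22 [G22 N22]].
    rewrite E1, Rmult_1_l in L11, L21, N11, N21. rewrite E2, Rmult_0_l in L12, L22, N12, N22.
    assert (HC : forall x, cos (s * lam * x ^ S d) = cos (lam * x ^ S d + 0)).
    { intros x. destruct Hs; subst; [f_equal; ring|]. rewrite <- cos_neg. f_equal. ring. }
    assert (HS : forall x, sin (s * lam * x ^ S d) = s * cos (lam * x ^ S d + - (PI / 2))).
    { intros x. rewrite <- cos_neg. replace (- (lam * x ^ S d + - (PI / 2))) with (PI / 2 - lam * x ^ S d) by ring.
      rewrite cos_shift. destruct Hs; subst; [rewrite Rmult_1_l; f_equal; ring|].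
      replace (-1 * lam * x ^ S d) with (- (lam * x ^ S d)) by ring. rewrite sin_neg. ring. }
    exists (fun e => ((J11 e + -1 * J22 e) + - s * (K12 e + 1 * K21 e), (J12 e + 1 * J21 e) + s * (K11 e + -1 * K22 e))).
    split.
    + intros eps He. unfold is_improper_RInt.
      apply (is_RInt_gen_ext (V := C_R_NormedModule) (fun x =>
        ((cos (lam * x ^ S d + 0) * (F1 O x * fst (chi (eps * x)))
           + -1 * (cos (lam * x ^ S d + 0) * (F2 O x * snd (chi (eps * x)))))
         + - s * (cos (lam * x ^ S d + - (PI / 2)) * (F1 O x * snd (chi (eps * x)))
           + 1 * (cos (lam * x ^ S d + - (PI / 2)) * (F2 O x * fst (chi (eps * x))))),
         (cos (lam * x ^ S d + 0) * (F1 O x * snd (chi (eps * x)))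
           + 1 * (cos (lam * x ^ S d + 0) * (F2 O x * fst (chi (eps * x)))))
         + s * (cos (lam * x ^ S d + - (PI / 2)) * (F1 O x * fst (chi (eps * x)))
           + -1 * (cos (lam * x ^ S d + - (PI / 2)) * (F2 O x * snd (chi (eps * x)))))))).
      * apply filter_forall. intros ab x _.
        unfold expi. rewrite HC, HS. unfold F1, F2. cbn [Derive_n].
        generalize (cos (lam * x ^ S d + 0)) (cos (lam * x ^ S d + - (PI / 2))). intros c1 c2.
        unfold Cmult, Re, Im. cbn [fst snd]. f_equal; ring.
      * apply (is_RInt_gen_pair (Rbar_locally m_infty) (Rbar_locally p_infty)); apply (is_RInt_gen_lincomb (Rbar_locally m_infty) (Rbar_locally p_infty));
          apply (is_RInt_gen_lincomb (Rbar_locally m_infty) (Rbar_locally p_infty)); auto.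
    + replace (W1 lam 0 - s * W2 lam (- (PI / 2))) with ((W1 lam 0 + -1 * 0) + - s * (0 + 1 * W2 lam (- (PI / 2)))) by ring.
      replace (W2 lam 0 + s * W1 lam (- (PI / 2))) with ((0 + 1 * W2 lam 0) + s * (W1 lam (- (PI / 2)) + -1 * 0)) by ring.
      apply (filterlim_pair_C (at_right 0)); apply (filterlim_lincomb (at_right 0)); apply (filterlim_lincomb (at_right 0)); assumption.
  (* [sum_n] up to M has M + 1 terms, hence [S M]. The real and the imaginary part each contribute
     C1 + C2. *)
  - intros M. destruct (A1 (S M)) as [C1 B1]. destruct (A2 (S M)) as [C2 B2].
    exists (2 * (C1 + C2)). intros lam Hl.
    pose proof (B1 lam 0 Hl) as D1. pose proof (B1 lam (- (PI / 2)) Hl) as D2.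
    pose proof (B2 lam 0 Hl) as D3. pose proof (B2 lam (- (PI / 2)) Hl) as D4.
    set (rr := Rpower lam (- (INR (S (S M)) / INR (S d)))) in *.
    eapply Rle_trans; [apply Cmod_le_sum|].
    assert (Hlin : forall (u v : nat -> R) c n, sum_n (fun k => u k + c * v k) n = psum u (S n) + c * psum v (S n)).
    { intros u v c n. rewrite <- psum_sum_n. induction (S n) as [|q IH]; simpl; [ring|]. rewrite IH. ring. }
    assert (S1 : fst (sum_n (G := C_AbelianGroup) (complex_coef s d a lam) M) =
      psum (line_coef d F1 lam 0) (S M) + - s * psum (line_coef d F2 lam (- (PI / 2))) (S M)).
    { rewrite fst_sum_n, <- Hlin. apply sum_n_ext. intros k. unfold complex_coef. cbn [fst]. fold F1 F2.
      match goal with |- ?u = ?v => change (@eq R u v) end. ring. }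
    assert (S2 : snd (sum_n (G := C_AbelianGroup) (complex_coef s d a lam) M) =
      psum (line_coef d F2 lam 0) (S M) + s * psum (line_coef d F1 lam (- (PI / 2))) (S M)).
    { rewrite snd_sum_n, <- Hlin. apply sum_n_ext. intros k. unfold complex_coef. cbn [snd]. fold F1 F2.
      match goal with |- ?u = ?v => change (@eq R u v) end. ring. }
    unfold Cminus, Cplus, Copp. cbn [fst snd]. rewrite S1, S2.
    replace (W1 lam 0 - s * W2 lam (- (PI / 2)) + - (psum (line_coef d F1 lam 0) (S M) + - s * psum (line_coef d F2 lam (- (PI / 2))) (S M)))
      with ((W1 lam 0 - psum (line_coef d F1 lam 0) (S M)) + - s * (W2 lam (- (PI / 2)) - psum (line_coef d F2 lam (- (PI / 2))) (S M))) by ring.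
    replace (W2 lam 0 + s * W1 lam (- (PI / 2)) + - (psum (line_coef d F2 lam 0) (S M) + s * psum (line_coef d F1 lam (- (PI / 2))) (S M)))
      with ((W2 lam 0 - psum (line_coef d F2 lam 0) (S M)) + s * (W1 lam (- (PI / 2)) - psum (line_coef d F1 lam (- (PI / 2))) (S M))) by ring.
    assert (T : forall u v c, Rabs c = 1 -> Rabs (u + c * v) <= Rabs u + Rabs v).
    { intros u v c Hc. eapply Rle_trans; [apply Rabs_triang|]. rewrite Rabs_mult, Hc. lra. }
    pose proof (T (W1 lam 0 - psum (line_coef d F1 lam 0) (S M)) (W2 lam (- (PI / 2)) - psum (line_coef d F2 lam (- (PI / 2))) (S M)) (- s)
      ltac:(rewrite Rabs_Ropp; auto)).
    pose proof (T (W2 lam 0 - psum (line_coef d F2 lam 0) (S M)) (W1 lam (- (PI / 2)) - psum (line_coef d F1 lam (- (PI / 2))) (S M)) s Hsabs).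
    lra.
Qed.

(** * Identification with the stated expansions *)

Lemma Cmult_sum_n (c : C) (u : nat -> C) (n : nat) :
  (c * sum_n (G := C_AbelianGroup) u n)%C = sum_n (G := C_AbelianGroup) (fun k => (c * u k)%C) n.
Proof.
  induction n; [rewrite !sum_O; reflexivity|]. rewrite !sum_Sn, <- IHn. apply Cmult_plus_distr_l.
Qed.

(** The stated sums group the Taylor coefficients of order 2k and 2k+1, so N = n + 1 terms
    correspond to the 2N coefficients of index 0 to 2n + 1. *)
Lemma sum_n_pairs (u : nat -> C) (n : nat) :
  sum_n (G := C_AbelianGroup) u (2 * n + 1) =
  sum_n (G := C_AbelianGroup) (fun k => (u (2 * k)%nat + u (2 * k + 1)%nat)%C) n.
Proof.
  induction n.
  - simpl Nat.add. rewrite sum_Sn, !sum_O. reflexivity.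
  - replace (2 * S n + 1)%nat with (S (S (2 * n + 1))) by lia. rewrite !sum_Sn, IHn.
    replace (S (2 * n + 1)) with (2 * S n)%nat by lia. replace (S (2 * S n)) with (2 * S n + 1)%nat by lia.
    symmetry. apply Cplus_assoc.
Qed.

Lemma line_coef_even_index d F lam th k :
  let al := INR (2 * k + 1) / INR (S d) in
  line_coef d F lam th (2 * k) =
  F (2 * k)%nat 0 / INR (fact (2 * k)) * ((cos (th + al * (PI / 2)) + cos ((-1) ^ S d * th + al * (PI / 2)))
    * (Gamma al / INR (S d) * Rpower lam (- al))).
Proof. unfold line_coef. rewrite pow_1_even, Rmult_1_l. replace (S (2 * k)) with (2 * k + 1)%nat by lia. reflexivity. Qed.

Lemma line_coef_odd_index d F lam th k :
  let al := INR (2 * k + 2) / INR (S d) in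
  line_coef d F lam th (2 * k + 1) =
  F (2 * k + 1)%nat 0 / INR (fact (2 * k + 1)) * ((cos (th + al * (PI / 2)) - cos ((-1) ^ S d * th + al * (PI / 2)))
    * (Gamma al / INR (S d) * Rpower lam (- al))).
Proof.
  unfold line_coef. replace (2 * k + 1)%nat with (S (2 * k)) by lia. rewrite pow_1_odd.
  replace (S (S (2 * k))) with (2 * k + 2)%nat by lia. cbv zeta. ring.
Qed.

Lemma cos_shift_neg x : cos (- (PI / 2) + x) = sin x.
Proof. rewrite <- cos_neg. replace (- (- (PI / 2) + x)) with (PI / 2 - x) by ring. apply cos_shift. Qed.

Lemma cos_shift_pos x : cos (PI / 2 + x) = - sin x.
Proof. replace (PI / 2 + x) with (PI / 2 - - x) by ring. rewrite cos_shift. apply sin_neg. Qed.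

(** For odd m the half-lines carry the angles [th] and -[th]. At angle 0 the cosines add for even
    index and cancel for odd index; at -pi/2 they become sin and -sin, which cancel for even index
    and add for odd index. Hence cosines go with even derivatives, i times sines with odd ones, and
    the factor is 2/m. *)
Lemma odd_expansion_eq (s : R) (l : nat) (a : R -> C) (n : nat) (lam : R) :
  odd_expansion s (S l) a (S n) lam =
  sum_n (G := C_AbelianGroup) (complex_coef s (2 * l) a lam) (2 * n + 1).
Proof.
  rewrite sum_n_pairs. unfold odd_expansion. cbv zeta.
  replace (S n - 1)%nat with n by lia. replace (2 * S l - 1)%nat with (S (2 * l)) by lia.
  rewrite Cmult_sum_n. apply sum_n_ext. intros k.
  unfold complex_coef. cbv zeta.
  rewrite !line_coef_even_index, !line_coef_odd_index. cbv zeta. rewrite pow_1_odd, !Rmult_0_r, !Rplus_0_l.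
  replace (-1 * - (PI / 2)) with (PI / 2) by ring. rewrite !cos_shift_neg, !cos_shift_pos.
  unfold Cderive_n.
  assert (Hm : INR (S (2 * l)) <> 0) by (apply not_0_INR; lia).
  replace (PI * INR (2 * k + 1) / (2 * INR (S (2 * l)))) with (INR (2 * k + 1) / INR (S (2 * l)) * (PI / 2)) by (field; auto).
  replace (PI * INR (2 * k + 2) / (2 * INR (S (2 * l)))) with (INR (2 * k + 2) / INR (S (2 * l)) * (PI / 2)) by (field; auto).
  pose proof (INR_fact_neq_0 (2 * k)) as Hf1. pose proof (INR_fact_neq_0 (2 * k + 1)) as Hf2.
  unfold Cdiv. rewrite <- !RtoC_inv by auto.
  generalize dependent (INR (fact (2 * k))). generalize dependent (INR (fact (2 * k + 1))).
  intros f2 Hf2 f1 Hf1.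
  set (al1 := INR (2 * k + 1) / INR (S (2 * l))). set (al2 := INR (2 * k + 2) / INR (S (2 * l))).
  generalize (cos (al1 * (PI / 2))) (sin (al1 * (PI / 2))) (cos (al2 * (PI / 2))) (sin (al2 * (PI / 2))).
  generalize (Gamma al1) (Gamma al2) (Rpower lam (- al1)) (Rpower lam (- al2)). clear al1 al2.
  generalize dependent (INR (S (2 * l))). intros m Hm g1 g2 p1 p2 c1 s1 c2 s2.
  generalize (Derive_n (fun t => Re (a t)) (2 * k) 0) (Derive_n (fun t => Im (a t)) (2 * k) 0)
    (Derive_n (fun t => Re (a t)) (2 * k + 1) 0) (Derive_n (fun t => Im (a t)) (2 * k + 1) 0).
  intros r1 i1 r2 i2.
  unfold Cplus, Cmult, RtoC, Ci. cbn [fst snd]. f_equal; field; auto.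
Qed.

(** For even m both half-lines carry the same angle: odd indices cancel, and even ones double to 2
    (cos + i s sin), an exponential, with 2/(2l) = 1/l. *)
Lemma even_expansion_eq (s : R) (l : nat) (a : R -> C) (n : nat) (lam : R) : s = 1 \/ s = -1 ->
  even_expansion s (S l) a (S n) lam =
  sum_n (G := C_AbelianGroup) (complex_coef s (2 * l + 1) a lam) (2 * n + 1).
Proof.
  intros Hs.
  rewrite sum_n_pairs. unfold even_expansion. cbv zeta.
  replace (S n - 1)%nat with n by lia. replace (2 * S l)%nat with (S (2 * l + 1)) by lia.
  rewrite Cmult_sum_n. apply sum_n_ext. intros k.
  unfold complex_coef. cbv zeta.
  rewrite !line_coef_even_index, !line_coef_odd_index. cbv zeta.
  replace ((-1) ^ S (2 * l + 1)) with 1 by (replace (S (2 * l + 1)) with (2 * (l + 1))%nat by lia; rewrite pow_1_even; reflexivity).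
  rewrite !Rmult_1_l, !Rplus_0_l, !Rminus_diag, !cos_shift_neg.
  unfold Cderive_n, expi.
  assert (Hm : INR (S (2 * l + 1)) <> 0) by (apply not_0_INR; lia).
  assert (Hl : INR (S (2 * l + 1)) = 2 * INR (S l)).
  { replace (S (2 * l + 1)) with (2 * S l)%nat by lia. rewrite mult_INR. reflexivity. }
  assert (Hl0 : INR (S l) <> 0) by (apply not_0_INR; lia).
  pose proof (INR_fact_neq_0 (2 * k)) as Hf1. pose proof (INR_fact_neq_0 (2 * k + 1)) as Hf2.
  unfold Cdiv. rewrite <- !RtoC_inv by auto.
  set (al := INR (2 * k + 1) / INR (S (2 * l + 1))).
  replace (cos (s * (PI / 2 * al))) with (cos (al * (PI / 2))).
  2:{ destruct Hs; subst s; [f_equal; ring|]. rewrite <- cos_neg. f_equal; ring. }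
  replace (sin (s * (PI / 2 * al))) with (s * sin (al * (PI / 2))).
  2:{ destruct Hs; subst s; [rewrite !Rmult_1_l; f_equal; ring|].
      replace (-1 * (PI / 2 * al)) with (- (al * (PI / 2))) by ring. rewrite sin_neg. ring. }
  clearbody al. rewrite Hl. generalize dependent (INR (S l)). intros m _ Hm0.
  generalize dependent (INR (fact (2 * k))). generalize dependent (INR (fact (2 * k + 1))).
  intros f2 Hf2 f1 Hf1.
  unfold Cplus, Cmult, RtoC. cbn [fst snd]. f_equal; field; auto.
Qed.

Lemma bigO_of_expansion (f : R -> C) (K p q : R) :
  p <= q -> (forall lam, 1 <= lam -> Cmod (f lam) <= K * Rpower lam (- q)) ->
  bigO_p_infty f (fun lam => Rpower lam (- p)).
Proof.
  intros Hpq H. exists (Rabs K). exists 1. intros lam Hl.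
  apply Rle_trans with (1 := H lam ltac:(lra)).
  apply Rle_trans with (Rabs K * Rpower lam (- q)).
  - apply Rmult_le_compat_r; [left; apply Rpower_pos|apply Rle_abs].
  - apply Rmult_le_compat_l; [apply Rabs_pos|]. apply Rpower_le_exp; lra.
Qed.

Theorem corollary6p2 :
  (forall (l : nat) (tau delta : R) (a : R -> C) (s : R),
     (1 <= l)%nat ->
     -1 <= delta < INR (2 * l - 1) - 1 ->
     amplitude tau delta a ->
     s = 1 \/ s = -1 ->
     exists I : R -> C,
       (forall lam : R, 0 < lam -> is_Os_int s lam (2 * l - 1) a (I lam)) /\
       forall N : nat, (1 <= N)%nat ->
         bigO_p_infty
           (fun lam => (I lam - odd_expansion s l a N lam)%C)
           (fun lam => Rpower lam (- (INR (N + 1) / INR (2 * l - 1)))))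
  /\
  (forall (l : nat) (tau delta : R) (a : R -> C) (s : R),
     (1 <= l)%nat ->
     -1 <= delta < INR (2 * l) - 1 ->
     amplitude tau delta a ->
     s = 1 \/ s = -1 ->
     exists I : R -> C,
       (forall lam : R, 0 < lam -> is_Os_int s lam (2 * l) a (I lam)) /\
       forall N : nat, (1 <= N)%nat ->
         bigO_p_infty
           (fun lam => (I lam - even_expansion s l a N lam)%C)
           (fun lam => Rpower lam (- (INR N / INR l)))).
Proof.
  split.
  - intros [|l] tau delta a s Hl Hd Ha Hs; [lia|].
    replace (2 * S l - 1)%nat with (S (2 * l)) in * by lia.
    destruct (Os_int_expansion (2 * l) tau delta a s) as [I [HI HE]]; auto.
    { rewrite S_INR in Hd. lra. }
    exists I. split; auto. intros [|n] HN; [lia|].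
    (* With N = n + 1 the remainder after 2N coefficients is O(lam^(-(2N+1)/m)), and 2N + 1 >= N +
       1. *)
    destruct (HE (2 * n + 1)%nat) as [K HK].
    apply (bigO_of_expansion _ K _ (INR (S (S (2 * n + 1))) / INR (S (2 * l)))).
    + apply Rmult_le_compat_r; [left; apply Rinv_0_lt_compat, lt_0_INR; lia|]. apply le_INR; lia.
    + intros lam Hlam. rewrite odd_expansion_eq. auto.
  - intros [|l] tau delta a s Hl Hd Ha Hs; [lia|].
    assert (Hdl : (2 * S l)%nat = S (2 * l + 1)) by lia. rewrite Hdl in *.
    destruct (Os_int_expansion (2 * l + 1) tau delta a s) as [I [HI HE]]; auto.
    { rewrite S_INR in Hd. lra. }
    exists I. split; auto. intros [|n] HN; [lia|].
    (* Again the exponent is (2N+1)/(2l), which is at least 2N/(2l) = N/l. *)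
    destruct (HE (2 * n + 1)%nat) as [K HK].
    apply (bigO_of_expansion _ K _ (INR (S (S (2 * n + 1))) / INR (S (2 * l + 1)))).
    + assert (0 < INR (S l)) by (apply lt_0_INR; lia).
      rewrite <- Hdl, mult_INR.
      replace (INR (S n) / INR (S l)) with (INR (2 * S n) / (INR 2 * INR (S l))).
      2:{ rewrite mult_INR. simpl (INR 2). field. lra. }
      apply Rmult_le_compat_r; [left; apply Rinv_0_lt_compat; simpl (INR 2); lra|]. apply le_INR; lia.
    + intros lam Hlam. rewrite even_expansion_eq; auto.
Qed.
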